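(* Let $D\ge 3$. Let $f:[0,+\infty)\to\mathbb{R}$ be a $C^1$ function with $f\not\equiv 0$, $f(0)=0$, $f(t)>0$ for $t>0$, satisfying the Keller-Osserman condition $\int^{+\infty}\frac{ds}{\sqrt{F(s)}}<+\infty$. Let $\rho:\mathbb{R}^D\to(0,+\infty)$ be a $C^1$ function satisfying $\lim_{|x|\to+\infty}\int_{\mathbb{R}^D}|x-y|^{2-D}\rho(y)\,dy=0$. Suppose also that for some $\alpha>2$, $$\rho(x)=|x|^{-\alpha}\quad\text{for }|x|\ge 1.$$ Then, given two entire large solutions $u_1,u_2$ of $\Delta u=\rho(x)f(u)$ in $\mathbb{R}^D$, there holds $$\lim_{|x|\to+\infty}[u_1(x)-u_2(x)]=0.$$
   Context: Here $F(s)=\int_a^s f(t)\,dt$, where $a>0$ is a fixed constant (since $f>0$ on $(0,+\infty)$, any $a>0$ may be used), and $\int^{+\infty}$ means integration over a neighborhood $[s_0,+\infty)$ of $+\infty$ with some $s_0>a$. An entire large solution is a classical ($C^2(\mathbb{R}^D)$) solution $u$ of $\Delta u=\rho(x)f(u)$, $u>0$ in $\mathbb{R}^D$, such that $\lim_{|x|\to+\infty}u(x)=+\infty$. *)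

(* Defs.v *)
From HB Require Import structures.
From mathcomp Require Import all_boot all_order all_algebra.
From mathcomp Require Import all_classical all_reals all_analysis.
Set Implicit Arguments. Unset Strict Implicit. Unset Printing Implicit Defensive.
Import Order.TTheory GRing.Theory Num.Theory.
Import numFieldNormedType.Exports.
Local Open Scope classical_set_scope.
Local Open Scope ring_scope.

(* The library norm `|x| on 'rV[R]_D is the sup norm; it induces the same
   topology as the Euclidean norm below. *)
Definition enorm (R : realType) (D : nat) (x : 'rV[R]_D) : R :=
  Num.sqrt (\sum_(i < D) x ord0 i ^+ 2).

(* The filter |x| -> +oo. *)
Definition rV_pinfty (R : realType) (D : nat) : set_system 'rV[R]_D :=
  filter_from [set: R] (fun M => [set x | M < enorm x]).
Arguments rV_pinfty : clear implicits.

Global Instance rV_pinfty_filter (R : realType) (D : nat) :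
  Filter (rV_pinfty R D).
Proof.
apply: filter_from_filter; first by exists 0.
move=> M N _ _; exists (Num.max M N) => // x /=.
by rewrite gt_max => /andP[].
Qed.

Global Instance rV_pinfty_proper (R : realType) (D : nat) :
  ProperFilter (rV_pinfty R D.+1).
Proof.
apply: filter_from_proper => M _; exists (const_mx (`|M| + 1)) => /=.
have M0 : 0 <= `|M| + 1 by rewrite addr_ge0.
have x1 : `|M| + 1 <= enorm (const_mx (`|M| + 1) : 'rV[R]_D.+1).
  rewrite -[leLHS]ger0_norm// -sqrtr_sqr /enorm ler_sqrt; last first.
    by rewrite sumr_ge0// => i _; rewrite sqr_ge0.
  by rewrite big_ord_recl mxE lerDl sumr_ge0// => i _; rewrite sqr_ge0.
by rewrite (lt_le_trans _ x1)// (le_lt_trans (ler_norm M))// ltrDl.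
Qed.

Definition basis_rV (R : realType) (D : nat) (i : 'I_D) : 'rV[R]_D :=
  delta_mx ord0 i.
Arguments basis_rV {R D} i.

Fixpoint class_C (R : realType) (D k : nat) (g : 'rV[R]_D -> R) : Prop :=
  continuous g /\
  if k is k'.+1 then
    forall i : 'I_D, (forall x, derivable g x (basis_rV i)) /\
                     class_C k' (fun x => 'D_(basis_rV i) g x)
  else True.

Definition laplacian (R : realType) (D : nat) (g : 'rV[R]_D -> R)
    (x : 'rV[R]_D) : R :=
  \sum_(i < D) 'D_(basis_rV i) (fun z => 'D_(basis_rV i) g z) x.

(* A function on [0, +oo) is encoded as f : R -> R whose values on negative
   numbers are never used; the derivative at 0 is one-sided. *)
Definition C1_half_line (R : realType) (f : R -> R) : Prop :=
  exists f' : R -> R,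
    {within `[0, +oo[, continuous f'} /\
    forall t, 0 <= t ->
      (f s - f t) / (s - t) @[s --> within `[0, +oo[ t^'] --> f' t.

Definition primitive (R : realType) (f : R -> R) (a s : R) : R :=
  \int[lebesgue_measure]_(t in `[a, s]) f t.

Definition Keller_Osserman (R : realType) (f : R -> R) (a : R) : Prop :=
  exists2 s0, a < s0 &
    (\int[lebesgue_measure]_(s in `[s0, +oo[)
       ((Num.sqrt (primitive f a s))^-1)%:E < +oo)%E.

Lemma measurable_cons_pair (R : realType) (n : nat) :
  measurable_fun [set: measurableTypeR R * n.-tuple (measurableTypeR R)]
    (fun p => [the n.+1.-tuple (measurableTypeR R) of p.1 :: p.2]).
Proof. exact: measurable_cons. Qed.

Section cons_measure.
Context (R : realType) (n : nat).
Variable m : {measure set (n.-tuple (measurableTypeR R)) -> \bar R}.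

Definition cons_measure : set (n.+1.-tuple (measurableTypeR R)) -> \bar R :=
  pushforward (lebesgue_measure \x^ m)%E
    (fun p => [the n.+1.-tuple (measurableTypeR R) of p.1 :: p.2]).

HB.instance Definition _ := Measure.copy cons_measure
  (measure_function_pushforward__canonical__measure_function_Measure
     (lebesgue_measure \x^ m)%E (@measurable_cons_pair R n)).

End cons_measure.

(* n-dimensional Lebesgue measure, as the n-fold product of the
   one-dimensional one. *)
Fixpoint lebesgue_tuple (R : realType) (n : nat) :
    {measure set (n.-tuple (measurableTypeR R)) -> \bar R} :=
  if n is n'.+1 then cons_measure (lebesgue_tuple R n') else dirac [tuple].

Lemma lebesgue_tuple_box (R : realType) (n : nat)
    (A : 'I_n -> set (measurableTypeR R)) :
  (forall i, measurable (A i)) ->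
  lebesgue_tuple R n [set y | forall i, A i (tnth y i)] =
  (\prod_(i < n) lebesgue_measure (A i))%E.
Proof.
elim: n A => [|n IHn] A mA.
  by rewrite big_ord0 /= diracE mem_set// => -[].
rewrite big_ord_recl /= /cons_measure /pushforward.
rewrite (_ : _ @^-1` _ =
  A ord0 `*` [set y : n.-tuple _ | forall i, A (lift ord0 i) (tnth y i)]).
  rewrite product_measure2E//; first by move=> *; congr (_ * _)%E; exact: (IHn (fun i => A (lift ord0 i))).
  rewrite (_ : [set _ | _] = \bigcap_(i in [set: 'I_n])
     ((fun y => tnth y i) @^-1` A (lift ord0 i))); last first.
    apply/seteqP; split => y /= h i; [move=> _; exact: h | exact: (h i I)].
  apply: fin_bigcap_measurable => // i _.
  by rewrite -[X in measurable X]setTI; exact: measurable_tnth.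
apply/seteqP; split => -[x y] /=.
  move=> h; split; first exact: (h ord0).
  by move=> i; have := h (lift ord0 i); rewrite tnthS.
move=> -[Ax Ay] i; case: (unliftP ord0 i) => [j ->|->]//.
by rewrite tnthS.
Qed.

Definition rV_of_tuple (R : realType) (D : nat)
  (y : D.-tuple (measurableTypeR R)) : 'rV[R]_D := \row_i tnth y i.

(* The value of the integrand at y = x (0, by convention on powR) is
   irrelevant, {x} being Lebesgue negligible. *)
Definition potential (R : realType) (D : nat) (rho : 'rV[R]_D -> R)
    (x : 'rV[R]_D) : \bar R :=
  (\int[lebesgue_tuple R D]_y
     (enorm (x - rV_of_tuple y) `^ (2 - D%:R) * rho (rV_of_tuple y))%:E)%E.

Definition entire_large_solution (R : realType) (D : nat)
    (rho : 'rV[R]_D -> R) (f : R -> R) (u : 'rV[R]_D -> R) : Prop :=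
  [/\ class_C 2 u,
      forall x, 0 < u x,
      forall x, laplacian u x = rho x * f (u x) &
      u x @[x --> rV_pinfty R D] --> +oo].

(* Main.v *)
Require Import Defs.
From HB Require Import structures.
From mathcomp Require Import all_boot all_order all_algebra.
From mathcomp Require Import all_classical all_reals all_analysis.
From mathcomp Require Import ring lra.
Set Implicit Arguments. Unset Strict Implicit. Unset Printing Implicit Defensive.
Import Order.TTheory GRing.Theory Num.Theory.
Import numFieldNormedType.Exports.
Local Open Scope classical_set_scope.
Local Open Scope ring_scope.

(** Let [k = D - 2], [b = alpha - 2] and [t = ln |x|]. Outside the unit ball a radial
    solution [N] satisfies [N'' + k N' = exp (- b t) f N]. By symmetry it suffices to
    show that [u1 - u2] is eventually smaller than any [e > 0].

    For a general [f] a solution plus a constant is not a supersolution, and the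
    values of [u1] and [u2] cannot be compared directly.
    Instead the radius at which a given value is taken is changed. Put
    [z = exp (- th t)] with [th = min (k, b / 2)], so that infinity becomes [z = 0].
    In this variable the radial equation reads [N_zz = (c / z) N_z + C z^m f N] with
    [c, m >= 0]. Suppose that a radial subsolution takes some value at [z] with
    slope [p = - N_z], and a new function takes it at [Y <= z] with a steeper slope
    [W]. Then the new function is again a subsolution in two cases: if
    [W^2 = p^2 + K] with a constant [K], or if [W = p / mu] with a constant [mu]
    and [Y <= mu z].

    Let [M t] be the maximum of [u1] over the ball of radius [exp t]. It is a
    subsolution of the radial equation in a weak sense ([second_difference]), and
    averaging yields smooth strict subsolutions [N] as close to it as desired
    ([smooth_subsolution]). From [N] a barrier below [u2] is built. In a fixed
    range and up to an arbitrary radius [exp t1] it has [W^2 = p^2 + S^2]; from there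
    on [W = p / mu], with [mu] such that the slopes agree at [t1]. The constant [S]
    is chosen once and for all, so large that the barrier starts where [u2] already
    exceeds its first value ([barrier_spread]). At the other end [Y] reaches a small
    value while [N] is still bounded, so that [u2] is larger there as well. In between,
    [u2] cannot fall below the barrier: one would dilate the barrier until it
    touches [u2] from below, and the equations of [u2] and of the strict
    subsolution are incompatible at the contact ([barrier_comparison]).

    It remains to see how far the barrier is below [N] at the radius [exp t1]. There
    [Y = mu z] and the slope of the barrier is [W1 = p1 / mu], so the difference is
    about [W1 (1 - mu) z = (W1 - p1) z <= S z] ([barrier_drop]). Since [z] tends to
    [0] as [t1] grows, so does the positive part of [u1 - u2]. *)

(** * One-variable calculus *)

(** A plain proposition rather than the type class [is_derive], so that derivatives
    of unknown functions are never searched for as instances. *)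
Definition deriv_at (R : realType) (f : R -> R) (x d : R) : Prop :=
  derivable f x 1 /\ 'D_1 f x = d.

Lemma deriv_atP (R : realType) (f : R -> R) (x d : R) :
  deriv_at f x d <-> is_derive x 1 f d.
Proof. by split => -[]. Qed.

Lemma deriv_at_eq (R : realType) (f : R -> R) (x d d' : R) :
  deriv_at f x d -> d = d' -> deriv_at f x d'.
Proof. by move=> fd <-. Qed.

Lemma deriv_at_cst (R : realType) (c x : R) : deriv_at (fun=> c) x 0.
Proof. apply/deriv_atP; exact: is_derive_cst. Qed.

Lemma deriv_at_id (R : realType) (x : R) : deriv_at id x 1.
Proof. apply/deriv_atP; exact: is_derive_id. Qed.

Lemma deriv_atD (R : realType) (f g : R -> R) (x a b : R) :
  deriv_at f x a -> deriv_at g x b -> deriv_at (fun y => f y + g y) x (a + b).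
Proof. move=> /deriv_atP fa /deriv_atP gb; apply/deriv_atP; exact: (is_deriveD fa gb). Qed.

Lemma deriv_atN (R : realType) (f : R -> R) (x a : R) :
  deriv_at f x a -> deriv_at (fun y => - f y) x (- a).
Proof. move=> /deriv_atP fa; apply/deriv_atP; exact: (is_deriveN fa). Qed.

Lemma deriv_atB (R : realType) (f g : R -> R) (x a b : R) :
  deriv_at f x a -> deriv_at g x b -> deriv_at (fun y => f y - g y) x (a - b).
Proof. move=> /deriv_atP fa /deriv_atP gb; apply/deriv_atP; exact: (is_deriveB fa gb). Qed.

Lemma deriv_atM (R : realType) (f g : R -> R) (x a b : R) :
  deriv_at f x a -> deriv_at g x b ->
  deriv_at (fun y => f y * g y) x (a * g x + f x * b).
Proof.
move=> /deriv_atP fa /deriv_atP gb; apply: deriv_at_eq.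
  by apply/deriv_atP; exact: (is_deriveM fa gb).
by rewrite /GRing.scale /= addrC (mulrC (g x)).
Qed.

Lemma deriv_atZ (R : realType) (f : R -> R) (c x a : R) :
  deriv_at f x a -> deriv_at (fun y => c * f y) x (c * a).
Proof. move=> /deriv_atP fa; apply/deriv_atP; exact: (is_deriveZ c fa). Qed.

Lemma deriv_at_comp (R : realType) (f g : R -> R) (x a b : R) :
  deriv_at f (g x) a -> deriv_at g x b -> deriv_at (fun y => f (g y)) x (a * b).
Proof.
move=> /deriv_atP fa /deriv_atP gb.
exact: (iffRL (deriv_atP _ _ _) (is_derive1_comp fa gb)).
Qed.

Lemma deriv_at_exp (R : realType) (f : R -> R) (x a : R) :
  deriv_at f x a -> deriv_at (fun y => expR (f y)) x (expR (f x) * a).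
Proof.
move=> fa; apply: (@deriv_at_comp R expR f x (expR (f x)) a _ fa).
exact: (iffRL (deriv_atP _ _ _) (is_derive_expR _)).
Qed.

Lemma deriv_at_ln (R : realType) (f : R -> R) (x a : R) :
  0 < f x -> deriv_at f x a -> deriv_at (fun y => ln (f y)) x (a / f x).
Proof.
move=> f0 fa; rewrite mulrC.
apply: (@deriv_at_comp R (@ln R) f x (f x)^-1 a _ fa).
exact: (iffRL (deriv_atP _ _ _) (is_derive1_ln f0)).
Qed.

Lemma deriv_at_sqrt (R : realType) (f : R -> R) (x a : R) :
  0 < f x -> deriv_at f x a ->
  deriv_at (fun y => Num.sqrt (f y)) x (a / (2 * Num.sqrt (f x))).
Proof.
move=> f0 fa; rewrite mulrC.
apply: (@deriv_at_comp R (@Num.sqrt R) f x (2 * Num.sqrt (f x))^-1 a _ fa).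
exact: (iffRL (deriv_atP _ _ _) (is_derive1_sqrt f0)).
Qed.

Lemma deriv_atV (R : realType) (f : R -> R) (x a : R) :
  f x != 0 -> deriv_at f x a ->
  deriv_at (fun y => (f y)^-1) x (- a / f x ^+ 2).
Proof.
move=> f0 /deriv_atP fa; apply: deriv_at_eq.
  by apply/deriv_atP; exact: (is_deriveV f0 fa).
by rewrite /GRing.scale /= mulrC mulrN mulNr -exprVn.
Qed.

Lemma deriv_at_continuous (R : realType) (f : R -> R) (x a : R) :
  deriv_at f x a -> {for x, continuous f}.
Proof. by move=> [fa _]; exact/differentiable_continuous/derivable1_diffP. Qed.

Lemma deriv_at_near (R : realType) (f g : R -> R) (x a : R) :
  (\forall y \near x, f y = g y) -> deriv_at f x a -> deriv_at g x a.
Proof.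
by move=> fg /deriv_atP fa; apply/deriv_atP; exact: (near_eq_is_derive fg fa).
Qed.

Lemma deriv_mean_value (R : realType) (f df : R -> R) (a b : R) : a < b ->
  (forall x, a <= x <= b -> deriv_at f x (df x)) ->
  exists2 c, a < c < b & f b - f a = df c * (b - a).
Proof.
move=> ab fd.
have d1 x : x \in `]a, b[ -> is_derive x 1 f (df x).
  by rewrite in_itv /= => /andP[ax xb]; apply/deriv_atP; apply: fd; rewrite !ltW.
have d2 : {within `[a, b], continuous f}.
  by apply: derivable_within_continuous => c /fd[].
have [c cab ->] := @MVT R f df a b ab d1 d2.
by exists c.
Qed.

Lemma deriv_ge0_le (R : realType) (f df : R -> R) (a b : R) : a <= b ->
  (forall x, a <= x <= b -> deriv_at f x (df x)) ->
  (forall x, a < x < b -> 0 <= df x) -> f a <= f b.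
Proof.
rewrite le_eqVlt => /predU1P[->//|ab] fd df0.
have [c cab fE] := deriv_mean_value ab fd.
by rewrite -subr_ge0 fE mulr_ge0 ?df0// subr_ge0 ltW.
Qed.

Lemma deriv_gt0_lt (R : realType) (f df : R -> R) (a b : R) : a < b ->
  (forall x, a <= x <= b -> deriv_at f x (df x)) ->
  (forall x, a < x < b -> 0 < df x) -> f a < f b.
Proof.
move=> ab fd df0.
have [c cab fE] := deriv_mean_value ab fd.
by rewrite -subr_gt0 fE mulr_gt0 ?df0// subr_gt0.
Qed.

Lemma deriv_le0_ge (R : realType) (f df : R -> R) (a b : R) : a <= b ->
  (forall x, a <= x <= b -> deriv_at f x (df x)) ->
  (forall x, a < x < b -> df x <= 0) -> f b <= f a.
Proof.
rewrite le_eqVlt => /predU1P[->//|ab] fd df0.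
have [c cab fE] := deriv_mean_value ab fd.
by rewrite -subr_le0 fE mulr_le0_ge0 ?df0// subr_ge0 ltW.
Qed.

(** A positive derivative at the single point [x] compares [g] with [g x] on both
    sides of [x], although [g] need not be monotone near [x]. *)
Lemma deriv_gt0_near (R : realType) (g : R -> R) (x d : R) :
  deriv_at g x d -> 0 < d ->
  exists2 e, 0 < e & forall h, 0 < h < e -> g (x - h) < g x < g (x + h).
Proof.
move=> [dg dE] d0; rewrite /derive in dE.
have {}dg : h^-1 *: ((g \o shift x) (h *: 1) - g x) @[h --> 0^'] --> d.
  by rewrite -dE.
have /cvgrPdist_lt /(_ _ d0) := dg.
rewrite near_withinE => /nbhs_ballP[e /= e0 He].
exists e => // h /andP[h0 he].
have key (t : R) : t != 0 -> `|t| < e -> 0 < t^-1 * (g (x + t) - g x).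
  move=> t0 te; have := He t.
  rewrite /ball /= sub0r normrN => /(_ te t0).
  by rewrite /= /GRing.scale /= mulr1 (addrC t x) ltr_distlC subrr => /andP[].
apply/andP; split.
  have := key (- h); rewrite oppr_eq0 gt_eqF// normrN gtr0_norm// => /(_ isT he).
  by rewrite invrN mulNr -mulrN pmulr_rgt0 ?invr_gt0// opprB subr_gt0.
have := key h; rewrite gt_eqF// gtr0_norm// => /(_ isT he).
by rewrite pmulr_rgt0 ?invr_gt0// subr_gt0.
Qed.

(** If [d] were positive, [F1] would be positive just after its zero [x], and [F]
    would increase there. *)
Lemma second_deriv_le0 (R : realType) (F F1 : R -> R) (x d : R) :
  (\forall y \near x, deriv_at F y (F1 y)) -> deriv_at F1 x d ->
  (\forall y \near x, F y <= F x) -> d <= 0.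
Proof.
move=> /nbhs_ballP[e1 /= e10 H1] F1d /nbhs_ballP[e2 /= e20 H2].
rewrite leNgt; apply/negP => d0.
have F1x : F1 x = 0.
  pose e := Num.min e1 e2.
  have e0 : 0 < e by rewrite lt_min e10.
  have xe : x \in `]x - e, x + e[ by rewrite in_itv /= ltrBlDr ltrDl e0.
  have bl t : t \in `]x - e, x + e[ -> `|x - t| < e.
    by rewrite in_itv /= => ?; rewrite ltr_distlC.
  have dF : deriv_at F x 0.
    apply/deriv_atP; apply: (@derive1_at_max _ F (x - e) (x + e)) => //.
    - by lra.
    - move=> t /bl; rewrite lt_min => /andP[te _].
      by have [] := H1 t te.
    - move=> t /bl; rewrite lt_min => /andP[_ te].
      exact: H2.
  have [_ <-] := H1 x (ballxx _ e10).
  by have [] := dF.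
have [e3 e30 H3] := deriv_gt0_near F1d d0.
pose h := (Num.min e1 (Num.min e2 e3)) / 2.
have m0 : 0 < Num.min e1 (Num.min e2 e3) by rewrite !lt_min e10 e20.
have h0 : 0 < h by rewrite divr_gt0.
have hm : h < Num.min e1 (Num.min e2 e3) by rewrite /h; lra.
move: hm; rewrite !lt_min => /and3P[h1 h2 h3].
have b1 c : x <= c <= x + h -> deriv_at F c (F1 c).
  move=> /andP[xc ch]; apply: H1; rewrite /ball /=.
  by rewrite distrC ger0_norm ?subr_ge0//; lra.
have xh : x < x + h by rewrite ltrDl.
have : F x < F (x + h).
  apply: (deriv_gt0_lt xh b1) => c cx.
  have cc : 0 < c - x < e3 by lra.
  have := H3 _ cc; rewrite F1x => /andP[_].
  by rewrite addrC subrK.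
apply/negP; rewrite -leNgt.
by apply: H2; rewrite /ball /= opprD addrA subrr sub0r normrN gtr0_norm.
Qed.

Lemma gt0_of_ln_gt0 (R : realType) (r : R) : 0 < ln r -> 0 < r.
Proof.
move=> lr; rewrite ltNge; apply/negP => r0.
by move: lr; rewrite ln0// ltxx.
Qed.

Lemma le_of_left_limit (R : realType) (N : R -> R) (a s B : R) :
  {for s, continuous N} -> a < s -> (forall r, a <= r -> r < s -> N r <= B) ->
  N s <= B.
Proof.
move=> cN as_ Hr; rewrite leNgt; apply/negP => BN.
have /nbhs_ballP[e /= e0 He] : \forall r \near s, B < N r.
  exact: (cvgr_gt _ cN).
pose r := Num.max a (s - e / 2).
have rs : r < s by rewrite gt_max as_ /= ltrBlDr ltrDl divr_gt0.
have ar : a <= r by rewrite le_max lexx.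
have : B < N r.
  apply: He; rewrite /ball /= gtr0_norm ?subr_gt0//.
  have : s - e / 2 <= r by rewrite le_max lexx orbT.
  by lra.
by rewrite ltNge Hr.
Qed.

Lemma first_passage (R : realType) (p : R -> R) (a c w : R) : a <= c ->
  (forall t, a <= t <= c -> {for t, continuous p}) -> p c <= w ->
  exists s, [/\ a <= s <= c, p s <= w & forall t, a <= t -> t < s -> w < p t].
Proof.
move=> ac cp pc.
pose S := [set s | a <= s <= c /\ p s <= w].
have Sc : S c by split => //; rewrite ac lexx.
have infS : has_inf S.
  by split; [exists c|exists a => s [/andP[]]].
have aS : a <= inf S by apply: lb_le_inf; [exists c|move=> s [/andP[]]].
have Sc' : inf S <= c by apply: ge_inf => //; case: infS.
have sI : a <= inf S <= c by rewrite aS.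
exists (inf S); split => //.
  rewrite leNgt; apply/negP => pS.
  have /nbhs_ballP[e /= e0 He] : \forall s \near inf S, w < p s.
    exact: (cvgr_gt _ (cp _ sI)).
  have [s [sac ps] se] := inf_adherent e0 infS.
  have iS : inf S <= s by apply: ge_inf => //; case: infS.
  have : w < p s.
    apply: He; rewrite /ball /= distrC ger0_norm ?subr_ge0//.
    by rewrite ltrBlDl.
  by rewrite ltNge ps.
move=> t at_ tS; rewrite ltNge; apply/negP => pt.
have : inf S <= t.
  apply: ge_inf; first by case: infS.
  by split => //; rewrite at_ (le_trans (ltW tS)).
by rewrite leNgt tS.
Qed.

(** [g] is only continuous to the right of [a]: it is frozen at [a'] before the
    fundamental theorem of calculus is applied. *)
Lemma antiderivative (R : realType) (g : R -> R) (a a' : R) : a < a' ->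
  (forall x, a < x -> {for x, continuous g}) ->
  exists G : R -> R, forall x, a' < x -> deriv_at G x (g x).
Proof.
move=> aa' cg.
pose gh x := g (Num.max x a').
have cmax : continuous (fun x : R => Num.max x a').
  move=> x; apply: (@continuous_max _ _ id (cst a') x); first exact: cvg_id.
  exact: cvg_cst.
have cgh : continuous gh.
  move=> x; apply: (continuous_comp (cmax x)); apply: cg.
  by rewrite lt_max aa' orbT.
exists (fun x => \int[lebesgue_measure]_(t in [set` `[a', x]]) gh t)%R => x a'x.
have int : lebesgue_measure.-integrable [set` `[a', x + 1]] (EFin \o gh).
  apply: continuous_compact_integrable; first exact: segment_compact.
  exact: continuous_subspaceT.
have x1 : x < x + 1 by rewrite ltrDl.
have [dG GE] := continuous_FTC1_closed x1 int a'x (cgh x).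
split => //; rewrite -derive1E GE /gh.
by rewrite max_l// ltW.
Qed.

Lemma deriv_at_shift (R : realType) (f : R -> R) (c x d : R) :
  deriv_at f (x + c) d -> deriv_at (fun y => f (y + c)) x d.
Proof.
move=> fd; apply: deriv_at_eq.
  apply: (@deriv_at_comp R f (fun y => y + c) x d (1 + 0)); first exact: fd.
  exact: (deriv_atD (deriv_at_id x) (deriv_at_cst c x)).
by rewrite addr0 mulr1.
Qed.

(** Two applications of the mean value theorem, first to [P2 (x + h) - P2 x] and
    then to [P1]. *)
Lemma second_difference_mean (R : realType) (P2 P1 g : R -> R) (s h : R) :
  0 < h -> (forall x, s <= x <= s + 2 * h -> deriv_at P2 x (P1 x)) ->
  (forall x, s <= x <= s + 2 * h -> deriv_at P1 x (g x)) ->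
  exists2 z, s < z < s + 2 * h &
    P2 (s + 2 * h) - 2 * P2 (s + h) + P2 s = h ^+ 2 * g z.
Proof.
move=> h0 d2 d1.
have sh : s < s + h by rewrite ltrDl.
have [|x sx Ex] := @deriv_mean_value R (fun x => P2 (x + h) - P2 x)
    (fun x => P1 (x + h) - P1 x) s (s + h) sh.
  move=> x sx; apply: deriv_atB; last by apply: d2; lra.
  by apply: deriv_at_shift; apply: d2; lra.
have xh : x < x + h by rewrite ltrDl.
have [|z xz Ez] := @deriv_mean_value R P1 g x (x + h) xh.
  by move=> z xz; apply: d1; lra.
exists z; first by lra.
have -> : s + 2 * h = s + h + h by ring.
have -> : h ^+ 2 * g z = (g z * (x + h - x)) * (s + h - s) by ring.
by rewrite -Ez -Ex; ring.
Qed.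

(** Heine-Cantor, in the form of a covering argument: the property of [h] holds for
    all small [h], locally uniformly in [x]. *)
Lemma uniformly_close_on_compact (R : realType) (V : normedModType R)
    (u : V -> R) (K : set V) (e : R) :
  continuous u -> compact K -> 0 < e ->
  exists2 h, 0 < h & forall x y, K x -> `|x - y| < h -> `|u x - u y| < e.
Proof.
move=> cu /compact_near_coveringP cK e0.
have near_x : (forall x, K x -> \forall x' \near x & h \near 0^'+,
     forall y, `|x' - y| < h -> `|u x' - u y| < e).
  move=> x Kx.
  have e2 : 0 < e / 2 by rewrite divr_gt0.
  have /nbhs_ballP[d /= d0 Hd] : \forall y \near x, `|u x - u y| < e / 2.
    by move/cvgrPdist_lt : (cu x); apply.
  exists (ball x (d / 2), [set h | h < d / 2]) => /=.
    split; first by apply: nbhsx_ballx; rewrite divr_gt0.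
    by apply: nbhs_right_lt; rewrite divr_gt0.
  move=> [x' h] /= [xx' hd] y x'y.
  rewrite -ball_normE /= in xx'.
  have xy : ball x d y.
    rewrite -ball_normE /=.
    have -> : x - y = (x - x') + (x' - y) by rewrite addrA subrK.
    by rewrite (le_lt_trans (ler_normD _ _))//; lra.
  have xx : ball x d x' by rewrite -ball_normE /=; lra.
  have -> : u x' - u y = (u x - u y) - (u x - u x').
    by ring.
  rewrite (le_lt_trans (ler_normB _ _))//.
  by have := Hd _ xy; have := Hd _ xx; rewrite /=; lra.
have /(_ _ near_x) := cK R (0^'+)
  (fun h x => forall y, `|x - y| < h -> `|u x - u y| < e) _.
rewrite near_withinE => /nbhs_ballP[d /= d0 Hd].
exists (d / 2); first by rewrite divr_gt0.
move=> x y Kx xy; apply: (Hd (d / 2)) => //.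
  by rewrite /ball /= sub0r normrN gtr0_norm; lra.
by rewrite divr_gt0.
Qed.

(** * The Laplacian and radial test functions *)

Lemma enorm_ge0 (R : realType) (D : nat) (x : 'rV[R]_D) : 0 <= enorm x.
Proof. exact: sqrtr_ge0. Qed.

Lemma sqr_enorm (R : realType) (D : nat) (x : 'rV[R]_D) :
  enorm x ^+ 2 = \sum_(i < D) x ord0 i ^+ 2.
Proof. by rewrite sqr_sqrtr// sumr_ge0// => i _; rewrite sqr_ge0. Qed.

Lemma enormZ (R : realType) (D : nat) (c : R) (x : 'rV[R]_D) :
  enorm (c *: x) = `|c| * enorm x.
Proof.
rewrite /enorm -sqrtr_sqr -sqrtrM ?sqr_ge0// mulr_sumr.
by congr Num.sqrt; apply: eq_bigr => i _; rewrite mxE exprMn.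
Qed.

Lemma continuous_enorm (R : realType) (D : nat) :
  continuous (@enorm R D).
Proof.
have cs : continuous (fun x : 'rV[R]_D => \sum_(i < D) x ord0 i ^+ 2).
  apply: (@continuous_big R^o) => [|i _ x]; first exact: add_continuous.
  have cx : {for x, continuous (fun y : 'rV[R]_D => y ord0 i)}.
    exact: coord_continuous.
  by apply: (cvgM cx cx).
by move=> x; apply: (continuous_comp (cs x)); exact: sqrt_continuous.
Qed.

Lemma normr_le_enorm (R : realType) (D : nat) (x : 'rV[R]_D) :
  `|x| <= enorm x.
Proof.
rewrite [`|x|]mx_normrE; apply/bigmax_leP; split => [|[i j] _ /=].
  exact: enorm_ge0.
rewrite ord1 -sqrtr_sqr /enorm ler_sqrt ?sumr_ge0// => [|k _]; last first.
  by rewrite sqr_ge0.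
by rewrite (bigD1 j)//= lerDl sumr_ge0// => k _; rewrite sqr_ge0.
Qed.

Lemma compact_enorm_le (R : realType) (D : nat) (r : R) :
  compact [set x : 'rV[R]_D | enorm x <= r].
Proof.
apply: bounded_closed_compact.
  exists `|r|; split; first exact: num_real.
  move=> M rM x /= xr.
  rewrite (le_trans (normr_le_enorm x))// (le_trans xr)// (le_trans (ler_norm r))//.
  exact: ltW.
have -> : [set x : 'rV[R]_D | enorm x <= r] = @enorm R D @^-1` [set y | y <= r].
  by [].
by apply: closed_comp; [move=> x _; exact: continuous_enorm | exact: closed_le].
Qed.

Lemma deriv_at_line (R : realType) (D : nat) (v : 'rV[R]_D -> R)
    (x e : 'rV[R]_D) (h : R) :
  derivable v (x + h *: e) e ->
  deriv_at (fun t => v (x + t *: e)) h ('D_e v (x + h *: e)).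
Proof.
have E : (fun t : R => t^-1 *: (((fun t => v (x + t *: e)) \o shift h) (t *: 1)
     - v (x + h *: e))) =
    (fun t : R => t^-1 *: ((v \o shift (x + h *: e)) (t *: e) - v (x + h *: e))).
  apply/funext => t /=; do 3 congr (_ _).
  by rewrite [t *: 1]mulr1 scalerDl addrCA.
by move=> dv; split; rewrite /derivable /derive E.
Qed.

(** The Laplacian of the radial function [Phi (ln |x|)] at [x] is
    [(Phi'' + (D - 2) Phi') / |x|^2], the derivatives being taken at [ln |x|];
    the logarithm makes the radial part an operator with constant coefficients.
    The bound is proved by the second derivative test along each coordinate axis,
    where [|x|^2] is the quadratic polynomial [q i]. *)
Lemma radial_test (R : realType) (D : nat) (v : 'rV[R]_D -> R)
    (Phi Phi1 : R -> R) (d2 : R) (x : 'rV[R]_D) :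
  class_C 2 v -> 0 < enorm x ->
  (forall t, deriv_at Phi t (Phi1 t)) -> deriv_at Phi1 (ln (enorm x)) d2 ->
  (\forall y \near x, v y - Phi (ln (enorm y)) <= v x - Phi (ln (enorm x))) ->
  laplacian v x <= (d2 + (D%:R - 2) * Phi1 (ln (enorm x))) / enorm x ^+ 2.
Proof.
move=> [cv v1] x0 dPhi dPhi1 vmax.
pose Q := enorm x ^+ 2.
have Q0 : 0 < Q by rewrite exprn_gt0.
pose q (i : 'I_D) h := Q + 2 * x ord0 i * h + h * h.
have qE i h : enorm (x + h *: basis_rV i) ^+ 2 = q i h.
  rewrite sqr_enorm (bigD1 i)//= !mxE eqxx eqxx /=.
  rewrite (eq_bigr (fun j => x ord0 j ^+ 2)) => [|j ji]; last first.
    by rewrite !mxE (negbTE ji) mulr0 addr0.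
  by rewrite /q /Q sqr_enorm [in RHS](bigD1 i)//=; ring.
have lnE i h : 0 < q i h -> ln (enorm (x + h *: basis_rV i)) = ln (q i h) / 2.
  rewrite -qE => q0.
  have n0 : 0 < enorm (x + h *: basis_rV i).
    rewrite lt_neqAle enorm_ge0 andbT; apply/eqP => n0.
    by move: q0; rewrite -n0 expr0n ltxx.
  by rewrite lnXn// mulr2n; lra.
have q00 i : q i 0 = Q by rewrite /q; lra.
have dq i h : deriv_at (q i) h (2 * x ord0 i + 2 * h).
  apply: deriv_at_eq.
    apply: deriv_atD.
      by apply: deriv_atD; [exact: deriv_at_cst|apply: deriv_atZ; exact: deriv_at_id].
    by apply: deriv_atM; exact: deriv_at_id.
  by rewrite /=; ring.
have q_near i : \forall h \near (0 : R), 0 < q i h.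
  have cq : {for (0:R), continuous (q i)} := deriv_at_continuous (dq i 0).
  by apply: (cvgr_gt _ cq); rewrite q00.
have lnQ : ln (enorm x) = ln Q / 2 by rewrite lnXn// mulr2n; lra.
have main i : 'D_(basis_rV i) (fun z => 'D_(basis_rV i) v z) x <=
    d2 * x ord0 i ^+ 2 / Q ^+ 2
    + Phi1 (ln (enorm x)) * (Q^-1 - 2 * x ord0 i ^+ 2 / Q ^+ 2).
  have [dv [_ /(_ i) [ddv _]]] := v1 i.
  set e : 'rV[R]_D := basis_rV i.
  pose F h := v (x + h *: e) - Phi (ln (q i h) / 2).
  pose F1 h := 'D_e v (x + h *: e) -
    Phi1 (ln (q i h) / 2) * (2^-1 * ((2 * x ord0 i + 2 * h) / q i h)).
  have dln h : 0 < q i h ->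
      deriv_at (fun h => ln (q i h) / 2) h
        (2^-1 * ((2 * x ord0 i + 2 * h) / q i h)).
    move=> qh; apply: (@deriv_at_near _ (fun h => 2^-1 * ln (q i h))).
      by near=> t; rewrite mulrC.
    by apply: deriv_atZ; apply: deriv_at_ln.
  rewrite -subr_le0.
  apply: (@second_deriv_le0 R F F1 0).
  - near=> h.
    have qh : 0 < q i h by near: h; exact: q_near.
    apply: deriv_atB; first exact: deriv_at_line.
    by apply: deriv_at_comp => //; exact: dln.
  - apply: deriv_at_eq.
      apply: deriv_atB.
        by apply: (@deriv_at_line R D (fun z => 'D_e v z)).
      apply: deriv_atM.
        apply: (@deriv_at_comp _ Phi1 (fun h => ln (q i h) / 2)).
          rewrite q00 -lnQ; exact: dPhi1.
        by apply: dln; rewrite q00.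
      apply: deriv_atZ; apply: deriv_atM.
        apply: deriv_atD; first exact: deriv_at_cst.
        by apply: deriv_atZ; exact: deriv_at_id.
      by apply: deriv_atV; [rewrite q00 gt_eqF|exact: dq].
    rewrite /= scale0r addr0 q00 -lnQ; congr (_ - _).
    by field; rewrite gt_eqF.
  - have xE : x = x + 0 *: e by rewrite scale0r addr0.
    have cl : {for (0 : R), continuous (fun h : R => x + h *: e)}.
      apply: cvgD; first exact: cvg_cst.
      by apply: cvgZr_tmp; exact: cvg_id.
    have {}cl : x + h *: e @[h --> (0 : R)] --> x by rewrite [X in _ --> X]xE.
    have clm := cl _ vmax.
    near=> h.
    have qh : 0 < q i h by near: h; exact: q_near.
    rewrite /F -lnE// q00 -lnQ -xE.
    by near: h; exact: clm.
have -> : (d2 + (D%:R - 2) * Phi1 (ln (enorm x))) / enorm x ^+ 2 =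
    \sum_(i < D) (d2 * x ord0 i ^+ 2 / Q ^+ 2
    + Phi1 (ln (enorm x)) * (Q^-1 - 2 * x ord0 i ^+ 2 / Q ^+ 2)).
  have -> : \sum_(i < D) (d2 * x ord0 i ^+ 2 / Q ^+ 2
      + Phi1 (ln (enorm x)) * (Q^-1 - 2 * x ord0 i ^+ 2 / Q ^+ 2)) =
    (d2 - 2 * Phi1 (ln (enorm x))) / Q ^+ 2 * (\sum_(i < D) x ord0 i ^+ 2)
    + \sum_(i < D) (Phi1 (ln (enorm x)) / Q).
    rewrite mulr_sumr -big_split /=; apply: eq_bigr => i _.
    by field; rewrite gt_eqF.
  rewrite -sqr_enorm sumr_const card_ord -mulr_natr -/Q.
  by field; rewrite gt_eqF.
by apply: ler_sum => i _; exact: main.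
Unshelve. all: by end_near. Qed.

Lemma local_max_laplacian_le0 (R : realType) (D : nat) (v : 'rV[R]_D -> R)
    (x : 'rV[R]_D) :
  class_C 2 v -> (\forall y \near x, v y <= v x) -> laplacian v x <= 0.
Proof.
move=> [cv v1] vmax; apply: sumr_le0 => i _.
have [dv [_ /(_ i) [ddv _]]] := v1 i.
set e : 'rV[R]_D := basis_rV i.
have xE : x = x + 0 *: e by rewrite scale0r addr0.
apply: (@second_deriv_le0 R (fun h => v (x + h *: e))
  (fun h => 'D_e v (x + h *: e)) 0).
- by near=> h; exact: deriv_at_line.
- have := @deriv_at_line R D (fun z => 'D_e v z) x e 0.
  by rewrite -xE; apply.
- have cl : {for (0 : R), continuous (fun h : R => x + h *: e)}.
    apply: cvgD; first exact: cvg_cst.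
    by apply: cvgZr_tmp; exact: cvg_id.
  have {}cl : x + h *: e @[h --> (0 : R)] --> x by rewrite [X in _ --> X]xE.
  by have := cl _ vmax; rewrite -xE.
Unshelve. all: by end_near. Qed.

Lemma class_CN (R : realType) (D n : nat) (v : 'rV[R]_D -> R) :
  class_C n v -> class_C n (fun x => - v x).
Proof.
elim: n v => [|n IHn] v [cv dv]; split => //.
- by move=> x; apply: continuousN; exact: cv.
- by move=> x; apply: continuousN; exact: cv.
- move=> i; have [dvi ci] := dv i; split.
    by move=> x; exact: derivableN.
  have -> : (fun x => 'D_(basis_rV i) (fun x => - v x) x) =
      (fun x => - 'D_(basis_rV i) v x).
    by apply/funext => x; rewrite -deriveN.
  exact: IHn.
Qed.

Lemma laplacianN (R : realType) (D : nat) (v : 'rV[R]_D -> R) (x : 'rV[R]_D) :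
  class_C 2 v -> laplacian (fun x => - v x) x = - laplacian v x.
Proof.
move=> [_ v1]; rewrite /laplacian -sumrN; apply: eq_bigr => i _.
have [dv [_ /(_ i) [ddv _]]] := v1 i.
have -> : (fun x => 'D_(basis_rV i) (fun x => - v x) x) =
    (fun x => - 'D_(basis_rV i) v x).
  by apply/funext => y; rewrite -deriveN.
by rewrite -deriveN.
Qed.

Lemma radial_test_min (R : realType) (D : nat) (v : 'rV[R]_D -> R)
    (Phi Phi1 : R -> R) (d2 : R) (x : 'rV[R]_D) :
  class_C 2 v -> 0 < enorm x ->
  (forall t, deriv_at Phi t (Phi1 t)) -> deriv_at Phi1 (ln (enorm x)) d2 ->
  (\forall y \near x, v x - Phi (ln (enorm x)) <= v y - Phi (ln (enorm y))) ->
  (d2 + (D%:R - 2) * Phi1 (ln (enorm x))) / enorm x ^+ 2 <= laplacian v x.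
Proof.
move=> cv x0 dPhi dPhi1 vmin.
rewrite -lerN2 -laplacianN//.
have -> : - ((d2 + (D%:R - 2) * Phi1 (ln (enorm x))) / enorm x ^+ 2) =
  (- d2 + (D%:R - 2) * - Phi1 (ln (enorm x))) / enorm x ^+ 2.
  by rewrite mulrN -opprD mulNr.
have dPhiN t : deriv_at (fun t => - Phi t) t (- Phi1 t) := deriv_atN (dPhi t).
apply: (radial_test (class_CN cv) x0 dPhiN (deriv_atN dPhi1)).
by apply: filterS vmin => y; lra.
Qed.

(** * Maxima over balls *)

(** What is used of a solution: outside the unit ball the weight is a pure power, and
    multiplication by [|x|^2] turns the equation into one whose radial form in
    [t = ln |x|] is [N'' + (D - 2) N' = exp (- b t) f N], with [b = alpha - 2]. *)
Definition exterior_solution (R : realType) (D : nat) (f : R -> R) (b : R)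
    (u : 'rV[R]_D -> R) : Prop :=
  [/\ class_C 2 u, forall x, 0 < u x, forall x, 0 < laplacian u x &
      forall x, 1 <= enorm x ->
        enorm x ^+ 2 * laplacian u x = expR (- b * ln (enorm x)) * f (u x)].

(** As a function of the logarithm of the radius. *)
Definition ball_max (R : realType) (D : nat) (u : 'rV[R]_D -> R) (t : R) : R :=
  sup [set u x | x in [set x | enorm x <= expR t]].

Lemma ball_max_attained (R : realType) (D : nat) (u : 'rV[R]_D -> R) (t : R) :
  continuous u ->
  exists x, [/\ enorm x <= expR t, ball_max u t = u x &
    forall y, enorm y <= expR t -> u y <= ball_max u t].
Proof.
move=> cu.
have [||c cK cmax] := @compact_EVT_max _ R u [set x | enorm x <= expR t] _
    (@compact_enorm_le R D (expR t)).
- exists 0 => /=; rewrite -(scale0r (0 : 'rV[R]_D)) enormZ normr0 mul0r.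
  exact: expR_ge0.
- exact: continuous_subspaceT.
rewrite inE /= in cK.
have cE : ball_max u t = u c.
  apply/eqP; rewrite eq_le; apply/andP; split.
    apply: ge_sup; first by exists (u c), c.
    by move=> _ [y /= yK <-]; apply: cmax; rewrite inE.
  apply: ub_le_sup; last by exists c.
  by exists (u c) => _ [y /= yK <-]; apply: cmax; rewrite inE.
by exists c; split => // y yK; rewrite cE; apply: cmax; rewrite inE.
Qed.

(** An interior maximum is excluded by the positive Laplacian; the maximum over the
    ball is thus the maximum over the sphere, and strictly increasing. *)
Lemma ball_max_on_sphere (R : realType) (D : nat) (u : 'rV[R]_D -> R)
    (t : R) (x : 'rV[R]_D) :
  class_C 2 u -> (forall x, 0 < laplacian u x) ->
  enorm x <= expR t -> u x = ball_max u t -> enorm x = expR t.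
Proof.
move=> cu lu xt ux; apply/eqP; rewrite eq_le xt /= leNgt; apply/negP => {}xt.
have [cu0 _] := cu.
have [_ [_ _ ymax]] := ball_max_attained t cu0.
have := lu x; apply/negP; rewrite -leNgt; apply: local_max_laplacian_le0 => //.
near=> y; rewrite ux; apply: ymax; rewrite ltW//; near: y.
have cx : {for x, continuous (@enorm R D)} := @continuous_enorm R D x.
exact: (cvgr_lt _ cx).
Unshelve. all: by end_near. Qed.

Lemma ball_max_lt (R : realType) (D : nat) (u : 'rV[R]_D -> R) (s t : R) :
  class_C 2 u -> (forall x, 0 < laplacian u x) ->
  s < t -> ball_max u s < ball_max u t.
Proof.
move=> cu lu st; have [cu0 _] := cu.
have [x [xs sx _]] := ball_max_attained s cu0.
have [_ [_ _ tmax]] := ball_max_attained t cu0.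
have est : expR s < expR t by rewrite ltr_expR.
have xt : enorm x <= expR t by rewrite (le_trans xs)// ltW.
rewrite lt_neqAle sx tmax// andbT; apply/eqP => E.
by have := ball_max_on_sphere cu lu xt E; move/eqP; rewrite lt_eqF// (le_lt_trans xs).
Qed.

Lemma ball_max_le (R : realType) (D : nat) (u : 'rV[R]_D -> R) (s t : R) :
  class_C 2 u -> (forall x, 0 < laplacian u x) ->
  s <= t -> ball_max u s <= ball_max u t.
Proof.
move=> cu lu; rewrite le_eqVlt => /predU1P[->//|st].
by apply: ltW; exact: ball_max_lt.
Qed.

(** A maximum point on the larger sphere is scaled down to the smaller one, where
    uniform continuity of [u] bounds the loss. *)
Lemma continuous_ball_max (R : realType) (D : nat) (u : 'rV[R]_D -> R) :
  class_C 2 u -> (forall x, 0 < laplacian u x) -> continuous (ball_max u).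
Proof.
move=> cu lu t0; have [cu0 _] := cu.
apply/cvgrPdist_lt => e e0.
pose B : R := expR (t0 + 1).
have B0 : 0 < B by exact: expR_gt0.
have [h h0 Hh] := uniformly_close_on_compact cu0 (@compact_enorm_le R D B) e0.
have key s t : s <= t -> t <= t0 + 1 -> (t - s) * B < h ->
    `|ball_max u s - ball_max u t| < e.
  move=> st tt0 tsB.
  rewrite distrC ger0_norm ?subr_ge0 ?ball_max_le//.
  have [x [xt tx _]] := ball_max_attained t cu0.
  have [_ [_ _ smax]] := ball_max_attained s cu0.
  pose y := expR (s - t) *: x.
  have ys : u y <= ball_max u s.
    apply: smax; rewrite enormZ gtr0_norm ?expR_gt0//.
    have -> : expR s = expR (s - t) * expR t by rewrite -expRD subrK.
    by rewrite ler_pM2l ?expR_gt0.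
  have xB : enorm x <= B by rewrite (le_trans xt)// ler_expR.
  have xy : `|x - y| < h.
    have -> : x - y = (1 - expR (s - t)) *: x by rewrite scalerBl scale1r.
    rewrite normrZ ger0_norm; last by rewrite subr_ge0 -expR0 ler_expR; lra.
    apply: le_lt_trans tsB; apply: ler_pM => //.
    - by rewrite subr_ge0 -expR0 ler_expR; lra.
    - by have := expR_ge1Dx (s - t); lra.
    - exact: le_trans (normr_le_enorm x) xB.
  have := Hh x y xB xy; rewrite tx => /ltr_normlW; lra.
have d0 : 0 < Num.min 1 (h / B) by rewrite lt_min ltr01 divr_gt0.
near=> t.
have : `|t0 - t| < Num.min 1 (h / B).
  by near: t; exact: (near_ball t0 _ d0).
rewrite lt_min => /andP[t1 tB].
have [tt|tt] := leP t0 t.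
- apply: key => //; first by move: t1; rewrite distrC ger0_norm ?subr_ge0//; lra.
  by rewrite -ltr_pdivlMr//; move: tB; rewrite distrC ger0_norm ?subr_ge0.
- rewrite distrC; apply: key; [exact: ltW|lra|].
  by rewrite -ltr_pdivlMr//; move: tB; rewrite gtr0_norm ?subr_gt0.
Unshelve. all: by end_near. Qed.

(** * A smooth strict radial subsolution close to the maxima *)

(** The inverse of [t |-> exp (- k (t + l))]. In the variable [s = exp (- k t)], that
    is [s = |x|^(2 - D)], harmonic radial functions are affine; the shift [l]
    dilates the solution. *)
Definition logrho (R : realType) (k l s : R) : R := - ln s / k - l.

Lemma logrhoK (R : realType) (k l s : R) : 0 < k -> 0 < s ->
  expR (- k * (logrho k l s + l)) = s.
Proof.
move=> k0 s0; rewrite /logrho subrK.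
have -> : - k * (- ln s / k) = ln s by field; rewrite gt_eqF.
by rewrite lnK.
Qed.

Lemma logrho_lt (R : realType) (k l s t : R) : 0 < k -> 0 < s -> s < t ->
  logrho k l t < logrho k l s.
Proof.
move=> k0 s0 st; rewrite /logrho ltrD2r ltr_pM2r ?invr_gt0//.
by rewrite ltrN2 ltr_ln// posrE (lt_trans s0).
Qed.

(** The maxima are a subsolution of the radial equation. As they need not be
    differentiable, this is expressed by their second difference in [s]: in the
    variable [s] the radial operator is a multiple of the second derivative. If
    the maxima rose above the quadratic polynomial [phi] with [phi'' = c] that
    agrees with them at both ends of the interval, the difference of [u] and the
    radial function [phi] would be largest at some point where [u] attains its
    maximum over a sphere and has too large a Laplacian. *)
Lemma second_difference (R : realType) (D : nat) (f : R -> R) (b k l s h c : R)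
    (u : 'rV[R]_D -> R) :
  exterior_solution f b u -> k = D%:R - 2 -> 0 < k -> 0 < s -> 0 < h ->
  (forall sg, s <= sg <= s + 2 * h -> 0 <= logrho k l sg /\
    k ^+ 2 * c * sg ^+ 2 <
      expR (- b * logrho k l sg) * f (ball_max u (logrho k l sg))) ->
  c * h ^+ 2 <= ball_max u (logrho k l s)
    - 2 * ball_max u (logrho k l (s + h)) + ball_max u (logrho k l (s + 2 * h)).
Proof.
move=> [cu _ lu eqn] kE k0 s0 h0 Hc; have [cu0 _] := cu.
pose G sg := ball_max u (logrho k l sg).
rewrite -!/(G _) leNgt; apply/negP => Hlt.
pose m := (G (s + 2 * h) - G s) / (2 * h).
pose phi sg := G s + m * (sg - s) + c / 2 * ((sg - s) * (sg - s - 2 * h)).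
pose phi1 sg := m + c * (sg - s - h).
have phis : phi s = G s by rewrite /phi; ring.
have phie : phi (s + 2 * h) = G (s + 2 * h).
  by rewrite /phi /m; field; rewrite gt_eqF.
have phim : phi (s + h) < G (s + h).
  have -> : phi (s + h) = (G s + G (s + 2 * h)) / 2 - c * h ^+ 2 / 2.
    by rewrite /phi /m; field; rewrite gt_eqF.
  lra.
have dphi sg : deriv_at phi sg (phi1 sg).
  apply: deriv_at_eq.
    apply: deriv_atD.
      apply: deriv_atD; first exact: deriv_at_cst.
      apply: deriv_atZ; apply: deriv_atB; [exact: deriv_at_id|exact: deriv_at_cst].
    apply: deriv_atZ; apply: deriv_atM.
      by apply: deriv_atB; [exact: deriv_at_id|exact: deriv_at_cst].
    apply: deriv_atB; last exact: deriv_at_cst.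
    by apply: deriv_atB; [exact: deriv_at_id|exact: deriv_at_cst].
  by rewrite /phi1 /=; field.
have dphi1 sg : deriv_at phi1 sg c.
  apply: deriv_at_eq.
    apply: deriv_atD; first exact: deriv_at_cst.
    apply: deriv_atZ; apply: deriv_atB; last exact: deriv_at_cst.
    by apply: deriv_atB; [exact: deriv_at_id|exact: deriv_at_cst].
  by rewrite /=; ring.
pose sig t := expR (- k * (t + l)).
have dsig t : deriv_at sig t (- k * sig t).
  apply: deriv_at_eq.
    apply: deriv_at_exp; apply: deriv_atZ.
    by apply: deriv_atD; [exact: deriv_at_id|exact: deriv_at_cst].
  by rewrite /sig; ring.
pose Phi t := phi (sig t).
pose Phi1 t := phi1 (sig t) * (- k * sig t).
have dPhi t : deriv_at Phi t (Phi1 t) by apply: deriv_at_comp.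
pose Phi2 t := c * (- k * sig t) * (- k * sig t)
  + phi1 (sig t) * (- k * (- k * sig t)).
have dPhi1 t : deriv_at Phi1 t (Phi2 t).
  by apply: deriv_atM; [exact: deriv_at_comp|exact: deriv_atZ].
have sigK sg : 0 < sg -> sig (logrho k l sg) = sg by exact: logrhoK.
have logK t : logrho k l (sig t) = t.
  by rewrite /logrho /sig expRK; field; rewrite gt_eqF.
have sig_lt t t' : t < t' -> sig t' < sig t.
  by move=> tt; rewrite ltr_expR ltr_nM2l ?oppr_lt0// ltrD2r.
have sig_le t t' : t <= t' -> sig t' <= sig t.
  by rewrite le_eqVlt => /predU1P[->//|tt]; apply: ltW; exact: sig_lt.
set t0 := logrho k l (s + 2 * h); set t1 := logrho k l s.
set tm := logrho k l (s + h).
have t01 : 0 <= t0.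
  have e : s <= s + 2 * h <= s + 2 * h by lra.
  by have [] := Hc _ e.
have t0m : t0 < tm by apply: logrho_lt => //; lra.
have tm1 : tm < t1 by apply: logrho_lt => //; lra.
pose K := [set x : 'rV[R]_D | enorm x <= expR t1] `&`
  [set x | expR t0 <= enorm x].
have cK : compact K.
  apply: compact_closedI; first exact: compact_enorm_le.
  have -> : [set x : 'rV[R]_D | expR t0 <= enorm x] =
    @enorm R D @^-1` [set y | expR t0 <= y] by [].
  by apply: closed_comp; [move=> x _; exact: continuous_enorm|exact: closed_ge].
have [xm [xmt xmE _]] := ball_max_attained tm cu0.
have xmE' : enorm xm = expR tm by apply: (ball_max_on_sphere cu lu).
have Kxm : K xm by split; rewrite /= xmE' ler_expR ltW.
have Kpos x : K x -> 0 < enorm x.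
  by move=> [_ /=]; apply: lt_le_trans; exact: expR_gt0.
pose w x := u x - Phi (ln (enorm x)).
have cwK : {in K, continuous w}.
  move=> x; rewrite inE => Kx.
  have cx : {for x, continuous (@enorm R D)} := @continuous_enorm R D x.
  have cl : {for x, continuous (fun x : 'rV[R]_D => ln (enorm x))}.
    by apply: (continuous_comp cx); apply: continuous_ln; exact: Kpos.
  have cp : {for x, continuous (fun x : 'rV[R]_D => Phi (ln (enorm x)))}.
    by apply: (continuous_comp cl); exact: deriv_at_continuous (dPhi _).
  exact: (continuousB (cu0 x) cp).
have cw : {within K, continuous w} := continuous_in_subspaceT cwK.
have [|x xK xmax] := compact_EVT_max _ cK cw; first by exists xm.
rewrite inE in xK.
have wmax y : K y -> w y <= w x by move=> Ky; apply: xmax; rewrite inE.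
have x0 := Kpos _ xK.
have wx0 : 0 < w x.
  apply: lt_le_trans (wmax _ Kxm).
  rewrite /w xmE' expRK /Phi /tm (sigK _ (addr_gt0 s0 h0)) -xmE -/(G _) subr_gt0.
  exact: phim.
pose t := ln (enorm x).
have xt : expR t = enorm x by rewrite lnK.
have tt1 : t <= t1 by rewrite -ler_expR xt; case: xK.
have tt0 : t0 <= t by rewrite -ler_expR xt; case: xK.
have uxG : u x = ball_max u t.
  have [y [yt yE ymax]] := ball_max_attained t cu0.
  have yE' : enorm y = expR t by apply: (ball_max_on_sphere cu lu).
  have := wmax y; rewrite /w yE' xt => wy.
  have {}wy : u y <= u x.
    have Ky : K y by split; rewrite /= yE' ler_expR.
    by have := wy Ky; lra.
  apply/eqP; rewrite eq_le ymax ?xt//= yE; exact: wy.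
have {}wx0 : phi (sig t) < G (sig t).
  by move: wx0; rewrite /w /Phi -/t uxG subr_gt0 /G logK.
have tt1' : t < t1.
  rewrite lt_neqAle tt1 andbT; apply/eqP => E.
  by move: wx0; rewrite E /t1 sigK// phis ltxx.
have tt0' : t0 < t.
  rewrite lt_neqAle tt0 andbT eq_sym; apply/eqP => E.
  by move: wx0; rewrite E /t0 sigK ?phie ?ltxx//; lra.
have lmax : \forall y \near x, u y - Phi (ln (enorm y)) <= u x - Phi (ln (enorm x)).
  have cx : {for x, continuous (@enorm R D)} := @continuous_enorm R D x.
  near=> y; apply: wmax; split => /=.
    apply: ltW; near: y; apply: (cvgr_lt _ cx).
    by rewrite -xt ltr_expR.
  apply: ltW; near: y; apply: (cvgr_gt _ cx).
  by rewrite -xt ltr_expR.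
have := radial_test cu x0 dPhi (dPhi1 (ln (enorm x))) lmax.
rewrite ler_pdivlMr ?exprn_gt0// mulrC eqn; last first.
  by rewrite -xt -expR0 ler_expR; lra.
rewrite -/t uxG -kE => ineq.
have sgt : s <= sig t <= s + 2 * h.
  have e1 : s = sig t1 by rewrite sigK.
  have e2 : s + 2 * h = sig t0 by rewrite sigK// ; lra.
  by rewrite e2 {1}e1; apply/andP; split; exact: sig_le.
have [_] := Hc _ sgt; rewrite logK; apply/negP; rewrite -leNgt.
apply: le_trans ineq _; rewrite /Phi2 /Phi1 le_eqVlt; apply/orP; left; apply/eqP.
by ring.
Unshelve. all: by end_near. Qed.

Lemma close_exponents (R : realType) (e a1 a2 c1 c2 c3 : R) :
  `|a1 - a2| < e / 8 -> `|c1 - c2| < e / 8 -> `|c1 - c3| < e / 8 ->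
  - (e / 2) + (a1 + c3) < a2 + c2.
Proof. by rewrite !ltr_norml => /andP[? ?] /andP[_ ?] /andP[? _]; lra. Qed.

(** Averaging the maxima twice over an interval of length [h] in the variable [s]
    gives a smooth function [F] whose second derivative is a second difference
    of the maxima, hence bounded below by [second_difference]. The average shifts the
    argument of [f] slightly; the strict inequality survives because the solution
    is first dilated by the factor [exp (- l)], which gains the factor
    [exp (b l)] in the equation, more than the oscillation of the right-hand
    side at scale [h]. The dilation and the average both lower the function, but
    not below the maxima at logarithmic radius [t - 2 l]. *)
Lemma smooth_subsolution (R : realType) (D : nat) (f : R -> R) (b k l T0 T1 : R)
    (u : 'rV[R]_D -> R) :
  exterior_solution f b u -> k = D%:R - 2 -> 0 < k -> 0 < b ->
  (forall t, 0 < t -> {for t, continuous f}) -> (forall t, 0 < t -> 0 < f t) ->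
  0 < l -> 2 * l < T0 -> T0 < T1 ->
  exists N N1 N2 : R -> R, forall t, T0 <= t <= T1 ->
    [/\ deriv_at N t (N1 t), deriv_at N1 t (N2 t), 0 < N1 t,
        expR (- b * t) * f (N t) < N2 t + k * N1 t &
        ball_max u (t - 2 * l) <= N t <= ball_max u t].
Proof.
move=> su kE k0 b0 cf f0 l0 lT0 T01.
have [cu u0 lu eqn] := su; have [cu0 _] := cu.
pose M := ball_max u.
have M0 t : 0 < M t.
  by have [x [_ E _]] := ball_max_attained t cu0; rewrite /M E; exact: u0.
have cM : continuous M := continuous_ball_max cu lu.
pose G sg := M (logrho k l sg).
have clog sg : 0 < sg -> {for sg, continuous (logrho k l)}.
  move=> sg0; apply: cvgB; last exact: cvg_cst.
  apply: cvgM; last exact: cvg_cst.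
  by apply: cvgN; exact: continuous_ln.
have cG sg : 0 < sg -> {for sg, continuous G}.
  by move=> sg0; apply: (continuous_comp (clog _ sg0)); exact: cM.
have ltG s t : 0 < s -> s < t -> G t < G s.
  by move=> s0 st; apply: ball_max_lt => //; exact: logrho_lt.
pose sa := expR (- k * T1); pose sb := expR (- k * T0).
have sa0 : 0 < sa by exact: expR_gt0.
have s20 : 0 < sa / 2 by rewrite divr_gt0.
have s40 : 0 < sa / 4 by rewrite divr_gt0.
have s42 : sa / 4 < sa / 2 by lra.
have [P1 dP1] := antiderivative s40 cG.
have cP1 x : sa / 4 < x -> {for x, continuous P1}.
  by move=> sx; exact: deriv_at_continuous (dP1 _ sx).
have [P2 dP2] := antiderivative s42 cP1.
(* logarithms of the two factors of the right-hand side, exp (- b t) / s^2 and f *)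
pose e1 sg := - b * logrho k l sg - 2 * ln sg.
pose b1 sg := ln (f (G sg)).
pose mx (x : R) := Num.max x (sa / 2).
have cmx : continuous mx.
  move=> x; apply: (@continuous_max _ _ id (cst (sa / 2)) x); first exact: cvg_id.
  exact: cvg_cst.
have mx0 x : 0 < mx x by rewrite lt_max s20 orbT.
have mxE x : sa <= x -> mx x = x by move=> sx; rewrite /mx max_l//; lra.
have ce : continuous (e1 \o mx).
  move=> x; apply: (continuous_comp (cmx x)); apply: cvgB.
    by apply: cvgM; [exact: cvg_cst|exact: clog].
  by apply: cvgM; [exact: cvg_cst|exact: continuous_ln].
have cb : continuous (b1 \o mx).
  move=> x; apply: (continuous_comp (cmx x)).
  have c1 : {for mx x, continuous (f \o G)}.
    by apply: (continuous_comp (cG _ (mx0 x))); apply: cf; exact: M0.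
  by apply: (continuous_comp c1); apply: continuous_ln; apply: f0; exact: M0.
have ep : 0 < b * l / 8 by rewrite divr_gt0// mulr_gt0.
have cK : compact `[sa, sb] by exact: segment_compact.
have [h1 h10 H1] := uniformly_close_on_compact ce cK ep.
have [h2 h20 H2] := uniformly_close_on_compact cb cK ep.
pose h := Num.min (Num.min h1 h2) (sa * (k * l)) / 3.
have m0 : 0 < Num.min (Num.min h1 h2) (sa * (k * l)).
  by rewrite !lt_min h10 h20 !mulr_gt0.
have h0 : 0 < h by rewrite divr_gt0.
have : 2 * h < Num.min (Num.min h1 h2) (sa * (k * l)) by rewrite /h; lra.
rewrite !lt_min => /andP[/andP[hh1 hh2] hh3].
pose F s := (P2 (s + 2 * h) - 2 * P2 (s + h) + P2 s) / h ^+ 2.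
pose F1 s := (P1 (s + 2 * h) - 2 * P1 (s + h) + P1 s) / h ^+ 2.
pose F2 s := (G (s + 2 * h) - 2 * G (s + h) + G s) / h ^+ 2.
have d2diff (P p : R -> R) s : (forall x, s <= x -> deriv_at P x (p x)) ->
    deriv_at (fun s => (P (s + 2 * h) - 2 * P (s + h) + P s) / h ^+ 2) s
      ((p (s + 2 * h) - 2 * p (s + h) + p s) / h ^+ 2).
  move=> dP.
  have dsh c : 0 <= c -> deriv_at (fun s => P (s + c)) s (p (s + c)).
    by move=> c0; apply: deriv_at_shift; apply: dP; lra.
  apply: (@deriv_at_near _
    (fun s => h ^- 2 * (P (s + 2 * h) - 2 * P (s + h) + P s))).
    by near=> y; rewrite mulrC.
  rewrite [X in deriv_at _ _ X]mulrC; apply: deriv_atZ; apply: deriv_atD.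
    apply: deriv_atB; first by apply: dsh; lra.
    by apply: deriv_atZ; apply: dsh; lra.
  by apply: dP.
have dF s : sa <= s -> deriv_at F s (F1 s).
  by move=> ss; apply: d2diff => x sx; apply: dP2; lra.
have dF1 s : sa <= s -> deriv_at F1 s (F2 s).
  by move=> ss; apply: d2diff => x sx; apply: dP1; lra.
pose sg t := expR (- k * t).
have dsg t : deriv_at sg t (- k * sg t).
  apply: deriv_at_eq.
    by apply: deriv_at_exp; apply: deriv_atZ; exact: deriv_at_id.
  by rewrite /sg; ring.
exists (fun t => F (sg t)), (fun t => F1 (sg t) * (- k * sg t)),
  (fun t => F2 (sg t) * (- k * sg t) * (- k * sg t)
     + F1 (sg t) * (- k * (- k * sg t))) => t /andP[Tt tT].
set s := sg t.
have ssa : sa <= s by rewrite ler_expR ler_nM2l// oppr_lt0.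
have ssb : s <= sb by rewrite ler_expR ler_nM2l// oppr_lt0.
have s0 : 0 < s by exact: expR_gt0.
have logs : logrho k l s = t - l.
  by rewrite /logrho /s /sg expRK; field; rewrite gt_eqF.
have log_ge z : s < z <= s + 2 * h -> t - 2 * l <= logrho k l z.
  move=> /andP[sz zs]; have z0 : 0 < z by lra.
  have zle : z <= expR (- k * (t - l)).
    have -> : - k * (t - l) = - k * t + k * l by ring.
    rewrite expRD -/(sg t) -/s.
    have klp := expR_ge1Dx (k * l).
    have : s * (1 + k * l) <= s * expR (k * l) by rewrite ler_pM2l.
    have : sa * (k * l) <= s * (k * l) by rewrite ler_pM2r// mulr_gt0.
    lra.
  have lz : ln z <= - k * (t - l) by rewrite -ler_expR lnK.
  have : (t - l) <= - ln z / k by rewrite ler_pdivlMr//; lra.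
  by rewrite /logrho; lra.
have log_le z : s < z -> logrho k l z <= t.
  by move=> sz; have := logrho_lt l k0 s0 sz; rewrite logs; lra.
(* an average of G over [s, s + 2 h] is a value of G *)
have [z sz Fz] : exists2 z, s < z < s + 2 * h & F s = G z.
  have [||z sz Ez] := @second_difference_mean R P2 P1 G s h h0.
  - by move=> x sx; apply: dP2; lra.
  - by move=> x sx; apply: dP1; lra.
  exists z => //; rewrite /F Ez mulrAC divff ?mul1r//.
  by rewrite expf_neq0// gt_eqF.
have [sz1 sz2] := andP sz.
have F1s : F1 s < 0.
  have sh : s < s + h by rewrite ltrDl.
  have shh : s + h < s + 2 * h by lra.
  have [|z1 sz1' Ez1] := @deriv_mean_value R P1 G s (s + h) sh.
    by move=> x sx; apply: dP1; lra.
  have [|z2 sz2' Ez2] := @deriv_mean_value R P1 G (s + h) (s + 2 * h) shh.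
    by move=> x sx; apply: dP1; lra.
  have -> : F1 s = (G z2 - G z1) / h.
    have -> : F1 s = ((P1 (s + 2 * h) - P1 (s + h)) - (P1 (s + h) - P1 s)) / h ^+ 2.
      by rewrite /F1; congr (_ / _); ring.
    by rewrite Ez1 Ez2; field; rewrite gt_eqF.
  by rewrite pmulr_llt0 ?invr_gt0// subr_lt0; apply: ltG; clear - s0 sz1' sz2'; lra.
have N1E : F1 s * (- k * s) = - F1 s * (k * s) by ring.
split.
- by apply: deriv_at_comp => //; exact: dF.
- apply: deriv_atM; last by apply: deriv_atZ; exact: dsg.
  by apply: deriv_at_comp => //; exact: dF1.
- by rewrite N1E mulr_gt0 ?oppr_gt0// mulr_gt0.
- have -> : F2 s * (- k * s) * (- k * s) + F1 s * (- k * (- k * s))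
      + k * (F1 s * (- k * s)) = k ^+ 2 * s ^+ 2 * F2 s by ring.
  (* half of the gained factor is spent on each of the two strict inequalities *)
  pose c := expR (- (b * l / 2)) * (expR (e1 s) * f (G z)) / k ^+ 2.
  have k2 : 0 < k ^+ 2 by rewrite exprn_gt0.
  have s2 : 0 < s ^+ 2 by rewrite exprn_gt0.
  have kc : k ^+ 2 * c = expR (- (b * l / 2)) * (expR (e1 s) * f (G z)).
    by rewrite /c mulrC divfK// gt_eqF.
  have es x : 0 < x -> expR (e1 x) * x ^+ 2 = expR (- b * logrho k l x).
    move=> x0; rewrite -[X in _ * X ^+ 2](lnK x0) -expRM_natl -expRD.
    by congr expR; rewrite /e1; ring.
  have Gz0 : 0 < f (G z) by apply: f0; exact: M0.
  have cF2 : c <= F2 s.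
    rewrite /F2 ler_pdivlMr ?exprn_gt0//.
    have := @second_difference R D f b k l s h c u su kE k0 s0 h0.
    have -> : ball_max u (logrho k l s) - 2 * ball_max u (logrho k l (s + h)) +
       ball_max u (logrho k l (s + 2 * h)) = G (s + 2 * h) - 2 * G (s + h) + G s.
      by rewrite /G /M; ring.
    apply => x /andP[sx xs].
    have x0 : 0 < x by lra.
    split.
      move: sx; rewrite le_eqVlt => /predU1P[<-|sx]; first by rewrite logs; lra.
      have sxs : s < x <= s + 2 * h by rewrite sx.
      by have := log_ge _ sxs; lra.
    rewrite kc -(es _ x0) (mulrAC (expR (e1 x))) ltr_pM2r ?exprn_gt0//.
    rewrite -/(M _) -/(G x) -[f (G z)]lnK// -[f (G x)]lnK; last by apply: f0; exact: M0.
    rewrite -!expRD ltr_expR -/(b1 z) -/(b1 x).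
    have Ks : [set` `[sa, sb]] s by rewrite /= in_itv /= ssa ssb.
    have sx2 : `|s - x| < h1 by rewrite distrC ger0_norm ?subr_ge0//; lra.
    have sx3 : `|s - x| < h2 by rewrite distrC ger0_norm ?subr_ge0//; lra.
    have sz3 : `|s - z| < h2 by rewrite distrC gtr0_norm ?subr_gt0//; lra.
    have ssx : sa <= x by apply: le_trans ssa _.
    have ssz : sa <= z by apply: le_trans ssa _; exact: ltW.
    move: (H1 _ _ Ks sx2) (H2 _ _ Ks sx3) (H2 _ _ Ks sz3).
    rewrite /= (mxE _ ssa) (mxE _ ssx) (mxE _ ssz).
    exact: close_exponents.
  apply: (@lt_le_trans _ _ (k ^+ 2 * s ^+ 2 * c)); last first.
    by rewrite ler_pM2l// mulr_gt0.
  have -> : k ^+ 2 * s ^+ 2 * c = (k ^+ 2 * c) * s ^+ 2 by ring.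
  have -> : F s = G z by [].
  rewrite kc mulrA [X in _ < X]mulrAC ltr_pM2r//.
  rewrite -[X in _ < X]mulrA (es _ s0) -expRD ltr_expR logs.
  have bl : 0 < b * l by rewrite mulr_gt0.
  by clear - bl; lra.
- have -> : F s = G z by [].
  apply/andP; split; apply: ball_max_le => //; last exact: log_le.
  by apply: log_ge; rewrite sz1 ltW.
Unshelve. all: by end_near. Qed.

(** * Contact between a radial barrier and a solution *)

(** The barrier is the curve [(T t, N t)], that is the radial function that takes the
    value [N t] at logarithmic radius [T t]; [w] is its slope. If the slope grows
    faster than [A] times the logarithmic radius at [s], the curve lies above
    its quadratic expansion with second coefficient [A]. The interval [[a, c]] may
    end at [s], so that a barrier made of two pieces can be treated one side at a
    time. *)
Lemma quadratic_minorant (R : realType) (N N1 T T1 w : R -> R) (a c s w1 A : R) :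
  a <= s <= c ->
  (forall t, a <= t <= c -> deriv_at N t (N1 t)) ->
  (forall t, a <= t <= c -> deriv_at T t (T1 t)) ->
  (forall t, a <= t <= c -> 0 < T1 t) ->
  (forall t, a <= t <= c -> N1 t = w t * T1 t) ->
  deriv_at w s w1 -> A * T1 s < w1 ->
  exists2 e, 0 < e & forall t, a <= t <= c -> `|t - s| < e ->
    N s + w s * (T t - T s) + A / 2 * (T t - T s) ^+ 2 <= N t.
Proof.
move=> sI dN dT T10 NwT dw Aw.
have dz : deriv_at (fun t => w t - A * T t) s (w1 - A * T1 s).
  by apply: deriv_atB => //; apply: deriv_atZ; exact: dT.
have z0 : 0 < w1 - A * T1 s by rewrite subr_gt0.
have [e e0 He] := deriv_gt0_near dz z0.
exists e => // t tI tse.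
pose Q t := N t - (w s * (T t - T s) + A / 2 * ((T t - T s) * (T t - T s))).
pose Q1 t := N1 t - (w s * T1 t + A / 2 *
  (T1 t * (T t - T s) + (T t - T s) * T1 t)).
have dQ x : a <= x <= c -> deriv_at Q x (Q1 x).
  move=> xI.
  have dTs : deriv_at (fun t => T t - T s) x (T1 x).
    by rewrite -[T1 x]subr0; apply: deriv_atB; [exact: dT|exact: deriv_at_cst].
  apply: deriv_atB; first exact: dN.
  by apply: deriv_atD; apply: deriv_atZ => //; exact: deriv_atM.
have Q1E x : a <= x <= c ->
    Q1 x = T1 x * ((w x - A * T x) - (w s - A * T s)).
  by move=> xI; rewrite /Q1 NwT//; field.
suff : Q s <= Q t by rewrite /Q; lra.
have [st|ts] := leP s t.
  apply: (@deriv_ge0_le R Q Q1 s t) => // x xI.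
    by apply: dQ; lra.
  rewrite Q1E; last by lra.
  apply: mulr_ge0; first by apply: ltW; apply: T10; lra.
  have xs : 0 < x - s < e.
    by move: tse; rewrite ger0_norm ?subr_ge0//; lra.
  by have := He _ xs; rewrite (addrC s (x - s)) subrK => /andP[_]; lra.
apply: (@deriv_le0_ge R Q Q1 t s); first exact: ltW.
  by move=> x xI; apply: dQ; lra.
move=> x xI; rewrite Q1E; last by lra.
apply: mulr_ge0_le0; first by apply: ltW; apply: T10; lra.
have xs : 0 < s - x < e.
  by move: tse; rewrite ltr0_norm ?subr_lt0//; lra.
by have := He _ xs; rewrite opprB (addrC s (x - s)) subrK => /andP[]; lra.
Qed.

Definition coercive (R : realType) (D : nat) (u : 'rV[R]_D -> R) : Prop :=
  forall B, exists r, forall x, r < enorm x -> B < u x.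

(** If the solution falls below the barrier somewhere, dilate the barrier by the
    largest factor for which it still meets the solution. The product
    [|x| exp (- T t)] is maximised instead of its logarithm because it is
    continuous at [x = 0]; [N] and [T] are frozen outside [[t0, tb]]. *)
Lemma farthest_contact (R : realType) (D : nat) (u : 'rV[R]_D -> R)
    (N T : R -> R) (t0 tb : R) :
  continuous u -> coercive u ->
  (forall t, t0 <= t <= tb -> {for t, continuous N}) ->
  (forall t, t0 <= t <= tb -> {for t, continuous T}) ->
  (forall s t, t0 <= s -> s <= t -> t <= tb -> N s <= N t) ->
  (forall t, t0 <= t <= tb -> 0 < T t) ->
  (exists x t, [/\ t0 <= t <= tb, T t < ln (enorm x) & u x <= N t]) ->
  exists x t, [/\ t0 <= t <= tb, T t < ln (enorm x), u x <= N t &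
    forall y s, t0 <= s <= tb -> ln (enorm x) - T t < ln (enorm y) - T s ->
      N s < u y].
Proof.
move=> cu ucoer cN cT Nle T0 [x1 [t1 [t1I x1T x1N]]].
have t0b : t0 <= tb by lra.
have [r Hr] := ucoer (N tb).
pose cl t := Num.max t0 (Num.min t tb).
have ccl : continuous cl.
  move=> t; apply: (@continuous_max _ _ (cst t0) (fun t => Num.min t tb) t).
    exact: cvg_cst.
  apply: (@continuous_min _ _ id (cst tb) t); first exact: cvg_id.
  exact: cvg_cst.
have clI t : t0 <= cl t <= tb.
  by rewrite /cl le_max lexx ge_max t0b ge_min lexx orbT.
have clE t : t0 <= t <= tb -> cl t = t.
  by move=> /andP[t0t ttb]; rewrite /cl min_l// max_r.
have cNc : continuous (fun t => N (cl t)).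
  by move=> t; apply: (continuous_comp (ccl t)); apply: cN.
have cTc : continuous (fun t => T (cl t)).
  by move=> t; apply: (continuous_comp (ccl t)); apply: cT.
pose K := ([set x : 'rV[R]_D | enorm x <= r] `*` [set` `[t0, tb]]) `&`
  [set p | u p.1 - N (cl p.2) <= 0].
have cfst (p : 'rV[R]_D * R) : {for p, continuous fst} by exact: cvg_fst.
have csnd (p : 'rV[R]_D * R) : {for p, continuous snd} by exact: cvg_snd.
have cK : compact K.
  apply: compact_closedI.
    apply: compact_setX; first exact: compact_enorm_le.
    exact: segment_compact.
  have -> : [set p : 'rV[R]_D * R | u p.1 - N (cl p.2) <= 0] =
    (fun p => u p.1 - N (cl p.2)) @^-1` [set y | y <= 0] by [].
  apply: closed_comp; last exact: closed_le.
  move=> p _.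
  have c1 : {for p, continuous (fun p : 'rV[R]_D * R => u p.1)}.
    exact: (continuous_comp (cfst p) (cu p.1)).
  have c2 : {for p, continuous (fun p : 'rV[R]_D * R => N (cl p.2))}.
    exact: (continuous_comp (csnd p) (cNc p.2)).
  exact: (continuousB c1 c2).
pose w (p : 'rV[R]_D * R) := enorm p.1 * expR (- T (cl p.2)).
have cw : continuous w.
  move=> p.
  have c1 : {for p, continuous (fun p : 'rV[R]_D * R => enorm p.1)}.
    exact: (continuous_comp (cfst p) (@continuous_enorm R D p.1)).
  have c2 : {for p, continuous (fun p : 'rV[R]_D * R => - T (cl p.2))}.
    exact: (continuousN (continuous_comp (csnd p) (cTc p.2))).
  have c3 : {for p, continuous (fun p : 'rV[R]_D * R => expR (- T (cl p.2)))}.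
    exact: (continuous_comp c2 (@continuous_expR R _)).
  exact: (continuousM c1 c3).
have inK x t : t0 <= t <= tb -> u x <= N t -> K (x, t).
  move=> tI uN; split; last by rewrite /= clE// subr_le0.
  split => /=; last by rewrite in_itv.
  rewrite leNgt; apply/negP => /Hr; apply/negP; rewrite -leNgt.
  by apply: (le_trans uN); apply: Nle; lra.
have wE x t : t0 <= t <= tb -> 0 < enorm x -> w (x, t) = expR (ln (enorm x) - T t).
  by move=> tI x0; rewrite /w /= clE// expRD lnK.
have K1 : K (x1, t1) by exact: inK.
have [|[x t] xK xmax] := compact_EVT_max _ cK (continuous_subspaceT cw).
  by exists (x1, t1).
rewrite inE in xK.
have {}xmax y s : t0 <= s <= tb -> u y <= N s -> w (y, s) <= w (x, t).
  by move=> sI uN; apply: xmax; rewrite inE; exact: inK.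
case: xK => -[/= xr]; rewrite in_itv /= => tI uN.
rewrite clE// subr_le0 in uN.
have Tx1 := T0 _ t1I.
have x10 : 0 < enorm x1 by apply: gt0_of_ln_gt0; lra.
have w1 : 1 < w (x, t).
  apply: lt_le_trans (xmax _ _ t1I x1N).
  by rewrite wE// -expR0 ltr_expR subr_gt0.
have x0 : 0 < enorm x.
  rewrite lt_neqAle enorm_ge0 andbT eq_sym; apply/eqP => E.
  by move: w1; rewrite /w /= E mul0r ltr10.
have Tx := T0 _ tI.
move: w1; rewrite wE// -expR0 ltr_expR subr_gt0 => Tlt.
exists x, t; split => // y s sI lt_ys.
have Ts := T0 _ sI.
have y0 : 0 < enorm y by apply: gt0_of_ln_gt0; lra.
rewrite ltNge; apply/negP => uNy.
have := xmax _ _ sI uNy; rewrite !wE// ler_expR; lra.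
Qed.

(** At the contact point [x] the solution lies above the barrier dilated by
    [exp dl], hence above the quadratic expansion of the barrier, which is a smooth
    radial function to which the second-order test applies. Inverting [T] locally
    is left to the intermediate value theorem. *)
Lemma contact_test (R : realType) (D : nat) (u : 'rV[R]_D -> R) (N T : R -> R)
    (a c t dl w A e : R) (x : 'rV[R]_D) :
  class_C 2 u -> 0 < enorm x -> a < t -> t < c ->
  (forall s, a <= s <= c -> {for s, continuous N}) ->
  (forall s, a <= s <= c -> {for s, continuous T}) ->
  (forall r s, a <= r -> r < s -> s <= c -> T r < T s) ->
  ln (enorm x) = T t + dl -> u x = N t ->
  (forall y s, a <= s <= c -> dl < ln (enorm y) - T s -> N s <= u y) ->
  0 < e -> (forall s, a <= s <= c -> `|s - t| < e ->
    N t + w * (T s - T t) + A / 2 * (T s - T t) ^+ 2 <= N s) ->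
  (A + (D%:R - 2) * w) / enorm x ^+ 2 <= laplacian u x.
Proof.
move=> cu x0 at_ tc cN cT Tlt ln_x uE far e0 minor.
pose d := Num.min e (Num.min (t - a) (c - t)) / 2.
have m0 : 0 < Num.min e (Num.min (t - a) (c - t)).
  by rewrite !lt_min e0 !subr_gt0 at_.
have d0 : 0 < d by rewrite divr_gt0.
have : d < Num.min e (Num.min (t - a) (c - t)).
  by rewrite /d ltr_pdivrMr// ltr_pMr// ltr1n.
rewrite !lt_min => /and3P[de d1 d2].
have cln : {for x, continuous (fun x : 'rV[R]_D => ln (enorm x))}.
  exact: (continuous_comp (@continuous_enorm R D x) (continuous_ln x0)).
have Tm : T (t - d) + dl < ln (enorm x).
  by rewrite ln_x ltrD2r; apply: Tlt; clear - d0 d1 tc; lra.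
have Tp : ln (enorm x) < T (t + d) + dl.
  by rewrite ln_x ltrD2r; apply: Tlt; clear - d0 d2 at_; lra.
pose Phi s := N t + w * (s - (dl + T t))
  + A / 2 * ((s - (dl + T t)) * (s - (dl + T t))).
pose Phi1 s := w + A * (s - (dl + T t)).
have did s : deriv_at (fun s => s - (dl + T t)) s 1.
  by rewrite -[1]subr0; apply: deriv_atB; [exact: deriv_at_id|exact: deriv_at_cst].
have dPhi s : deriv_at Phi s (Phi1 s).
  apply: deriv_at_eq.
    apply: deriv_atD.
      by apply: deriv_atD; [exact: deriv_at_cst|apply: deriv_atZ; exact: did].
    by apply: deriv_atZ; apply: deriv_atM; exact: did.
  by rewrite /Phi1; field.
have dPhi1 s : deriv_at Phi1 s A.
  apply: deriv_at_eq.
    by apply: deriv_atD; [exact: deriv_at_cst|apply: deriv_atZ; exact: did].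
  by rewrite add0r mulr1.
have above : \forall y \near x,
    u x - Phi (ln (enorm x)) <= u y - Phi (ln (enorm y)).
  have -> : u x - Phi (ln (enorm x)) = 0.
    by rewrite uE /Phi ln_x; ring.
  near=> y.
  have ym : T (t - d) + dl < ln (enorm y) by near: y; exact: (cvgr_gt _ cln).
  have yp : ln (enorm y) < T (t + d) + dl by near: y; exact: (cvgr_lt _ cln).
  have tdI s : t - d <= s <= t + d -> a <= s <= c by clear - d1 d2; lra.
  have [s sd Ts] :
      exists2 s, t - d <= s <= t + d & T s = ln (enorm y) - dl.
    have td : t - d <= t + d by clear - d0; lra.
    have cTd : {within `[t - d, t + d], continuous T}.
      apply: continuous_in_subspaceT => s; rewrite inE /= in_itv /= => sI.
      exact/cT/tdI.
    have [|s sI sE] := @IVT R T (t - d) (t + d) (ln (enorm y) - dl) td cTd.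
      rewrite ge_min le_max; apply/andP; split; apply/orP; [left|right].
        by clear - ym; lra.
      by clear - yp; lra.
    by exists s.
  have sI := tdI _ sd.
  have Ns : N s <= u y.
    have as_ : a < s by clear - sd d1; lra.
    apply: (le_of_left_limit (cN _ sI) as_) => r ar rs.
    have rI : a <= r <= c by clear - ar rs sI; lra.
    have [_ sc] := andP sI.
    apply: far => //; have := Tlt _ _ ar rs sc; rewrite Ts.
    by clear; lra.
  have st : `|s - t| < e by rewrite ltr_norml; clear - sd de; lra.
  have := minor _ sI st; rewrite Ts => mN.
  rewrite subr_ge0; apply: le_trans Ns; apply: le_trans mN.
  by rewrite /Phi le_eqVlt; apply/orP; left; apply/eqP; ring.
have := radial_test_min cu x0 dPhi (dPhi1 _) above.
by have -> : Phi1 (ln (enorm x)) = w by rewrite /Phi1 ln_x; ring.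
Unshelve. all: by end_near. Qed.

(** * The barrier *)

(** The barrier keeps the values of the radial subsolution [N] and moves the value
    [N t] from [z = exp (- th t)] to a smaller number [Y t], where [dY / dz] is
    [barrier_slope]. Here [p = exp (th t) N'] is [- th] times the derivative of [N] in
    [z], and the corresponding slope of the barrier is [p] divided by [dY / dz]. Up
    to [t1] it has the square [p^2 + K]; beyond [t1] the passage from [z] to [Y] is
    affine, a dilation up to a small shift, with the same derivative at [t1]. *)
Definition barrier_slope (R : realType) (th K t1 : R) (N1 : R -> R) (t : R) : R :=
  let p s := expR (th * s) * N1 s in
  let m := Num.min t t1 in p m / Num.sqrt (p m ^+ 2 + K).

(** Beyond [t1] the barrier is a subsolution: [Y <= mu z] makes the drift term of
    the radial equation in [z], which is proportional to the slope over [z], at least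
    that of a dilation of [N], and the weight is not larger at [Y] than at [z].
    Here [E] is [exp (- b T) f] at the barrier, [j] the corresponding term for [N],
    and [q] is [p']. *)
Lemma barrier_scaled_ineq (R : realType) (z Y p q mu j k th E : R) :
  0 < p -> 0 < Y -> 0 < z -> 0 < mu -> mu <= 1 -> 0 <= E -> th <= k ->
  Y <= mu * z -> - (k - th) * p + j < q -> z * E <= Y ^+ 2 * j ->
  (E - k * (Y * p / mu)) * (z * mu / Y) < (- th * z * mu * p + Y * q) / mu.
Proof.
move=> p0 Y0 z0 mu0 mu1 E0 thk Ymu pq zE.
rewrite ltr_pdivlMr//.
rewrite [X in X < _](_ : _ = (z * mu ^+ 2 * E - k * z * mu * Y * p) / Y); last first.
  by field; rewrite !gt_eqF.
rewrite ltr_pdivrMr//.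
have h1 : Y ^+ 2 * (- (k - th) * p + j) < Y ^+ 2 * q by rewrite ltr_pM2l ?exprn_gt0.
have h2 : 0 <= (k - th) * (Y * p * (mu * z - Y)).
  by rewrite mulr_ge0 ?subr_ge0// mulr_ge0 ?subr_ge0// ltW// mulr_gt0.
have h3 : z * E * mu ^+ 2 <= z * E.
  by rewrite ler_piMr ?mulr_ge0 ?(ltW z0)// expr_le1// ltW.
nra.
Qed.

(** Up to [t1] the barrier is a subsolution: half the squared slope has the same
    derivative with respect to the value as for [N], the drift term of the radial
    equation in [z] is not smaller for the steeper slope [W] at [Y <= z], and the
    weight is not larger at [Y] than at [z]. *)
Lemma barrier_energy_ineq (R : realType) (z Y p q W j k th E : R) :
  0 < p -> 0 < Y -> 0 < z -> p <= W -> th <= k ->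
  Y <= z -> - (k - th) * p + j < q -> z * E <= Y ^+ 2 * j ->
  (E - k * (Y * W)) * (z * p / (W * Y)) < - th * z * p + Y * (p * q / W).
Proof.
move=> p0 Y0 z0 pW thk Yz pq zE.
have W0 : 0 < W by lra.
rewrite [X in X < _](_ : _ = (z * E - k * z * Y * W) * (p / (W * Y))); last first.
  by field; rewrite !gt_eqF.
rewrite [X in _ < X](_ : _ = (- th * z * W * Y + Y ^+ 2 * q) * (p / (W * Y)));
  last by field; rewrite !gt_eqF.
rewrite ltr_pM2r; last by rewrite divr_gt0// mulr_gt0.
have h1 : Y ^+ 2 * (- (k - th) * p + j) < Y ^+ 2 * q by rewrite ltr_pM2l ?exprn_gt0.
have h2 : 0 <= (k - th) * (Y * (z * W - Y * p)).
  rewrite mulr_ge0 ?subr_ge0// mulr_ge0 ?(ltW Y0)// subr_ge0.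
  by apply: ler_pM => //; exact: ltW.
nra.
Qed.

(** In the variable [z = exp (- th t)] the weight of the equation is the power
    [z^(b / th - 2)], up to a constant; it is nondecreasing because [2 th <= b]. *)
Lemma mass_exponent (R : realType) (th b t T : R) : 2 * th <= b -> t <= T ->
  expR (- th * t) * expR (- b * T)
    <= expR (- th * T) ^+ 2 * expR ((th - b) * t).
Proof.
move=> thb tT; rewrite -expRM_natl -!expRD ler_expR.
have : 0 <= (b - 2 * th) * (T - t) by rewrite mulr_ge0 ?subr_ge0.
lra.
Qed.

(** At the farthest contact of the solution with a dilated barrier, the test
    [contact_test] bounds the second-order coefficient of the barrier by the
    equation for [u] at the larger radius, where the weight is strictly smaller.
    The coefficient [A] is chosen such that the barrier would satisfy the equation
    with equality at its own radius; since it is a strict subsolution, its slope grows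
    faster than that on either side of the contact. The kink of [barrier_slope] at
    [t1] is harmless, as both one-sided bounds use the same [A]. *)
Lemma barrier_comparison (R : realType) (D : nat) (f : R -> R)
    (b k th K t0 t1 tb : R) (u : 'rV[R]_D -> R) (N N1 N2 Y : R -> R) :
  exterior_solution f b u -> coercive u -> k = D%:R - 2 ->
  0 < th -> th <= k -> 2 * th <= b -> 0 < K -> (forall s, 0 < s -> 0 < f s) ->
  0 < t0 -> t0 <= t1 -> t1 <= tb ->
  (forall t, t0 <= t <= tb -> 0 < N t) ->
  (forall t, t0 <= t <= tb -> deriv_at N t (N1 t)) ->
  (forall t, t0 <= t <= tb -> deriv_at N1 t (N2 t)) ->
  (forall t, t0 <= t <= tb -> 0 < N1 t) ->
  (forall t, t0 <= t <= tb -> expR (- b * t) * f (N t) < N2 t + k * N1 t) ->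
  (forall t, t0 <= t <= tb ->
    deriv_at Y t (- th * expR (- th * t) * barrier_slope th K t1 N1 t)) ->
  (forall t, t0 <= t <= tb -> 0 < Y t) ->
  (forall t, t0 <= t <= tb -> Y t <= expR (- th * t)) ->
  (forall t, t1 <= t <= tb ->
    Y t <= barrier_slope th K t1 N1 t1 * expR (- th * t)) ->
  (forall x, - ln (Y t0) / th < ln (enorm x) -> N t0 < u x) ->
  (forall x, - ln (Y tb) / th < ln (enorm x) -> N tb < u x) ->
  forall x t, t0 <= t <= tb -> - ln (Y t) / th < ln (enorm x) -> N t < u x.
Proof.
move=> [cu u0 lu eqn] ucoer kE th0 thk thb K0 f0 t00 t01 t1b N0 dN dN1 N10 sub
  dY Y0 Yle Ymu H0 Hb.
have [cu0 _] := cu.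
have b0 : 0 < b by lra.
have k0 : 0 < k by lra.
pose T t := - ln (Y t) / th.
pose p t := expR (th * t) * N1 t.
pose W t := Num.sqrt (p t ^+ 2 + K).
pose g := barrier_slope th K t1 N1.
pose mu := p t1 / W t1.
have p0 t : t0 <= t <= tb -> 0 < p t.
  by move=> tI; rewrite mulr_gt0 ?expR_gt0 ?N10.
have pW t : t0 <= t <= tb -> p t < W t.
  move=> tI; rewrite -[ltLHS]ger0_norm ?(ltW (p0 _ tI))// -sqrtr_sqr.
  by rewrite ltr_sqrt ?ltrDl// ltr_wpDl// sqr_ge0.
have W0 t : t0 <= t <= tb -> 0 < W t.
  by move=> tI; apply: lt_trans (pW _ tI); exact: p0.
have t1I : t0 <= t1 <= tb by rewrite t01.
have gl t : t <= t1 -> g t = p t / W t by move=> tt; rewrite /g /barrier_slope min_l.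
have gr t : t1 <= t -> g t = mu.
  by move=> tt; rewrite /g /barrier_slope min_r.
have mu0 : 0 < mu by rewrite divr_gt0 ?p0 ?W0.
have mu1 : mu <= 1 by rewrite ler_pdivrMr ?W0// mul1r ltW// pW.
have g0 t : t0 <= t <= tb -> 0 < g t.
  move=> tI; have [tt|tt] := leP t t1; first by rewrite gl// divr_gt0 ?p0 ?W0.
  by rewrite gr// ltW.
have YT t : t0 <= t <= tb -> Y t = expR (- th * T t).
  move=> tI; have -> : - th * T t = ln (Y t) by rewrite /T; field; rewrite gt_eqF.
  by rewrite lnK//; exact: Y0.
have Tge t : t0 <= t <= tb -> t <= T t.
  move=> tI; have := Yle _ tI; rewrite YT// ler_expR.
  by rewrite !mulNr lerN2 ler_pM2l.
pose T1 t := expR (- th * t) * g t / Y t.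
have dT t : t0 <= t <= tb -> deriv_at T t (T1 t).
  move=> tI; rewrite (_ : T = (fun t => (- th^-1) * ln (Y t))); last first.
    by apply/funext => s; rewrite /T; ring.
  apply: deriv_at_eq.
    by apply: deriv_atZ; apply: deriv_at_ln; [exact: Y0|exact: dY].
  by rewrite /T1 /g; field; rewrite !gt_eqF// Y0.
have T10 t : t0 <= t <= tb -> 0 < T1 t.
  by move=> tI; rewrite divr_gt0 ?Y0// mulr_gt0 ?expR_gt0 ?g0.
have Tlt s t : t0 <= s -> s < t -> t <= tb -> T s < T t.
  move=> s0 st ttb; apply: (deriv_gt0_lt (df := T1) st) => c cI.
    by apply: dT; lra.
  by apply: T10; lra.
have Nlt s t : t0 <= s -> s < t -> t <= tb -> N s < N t.
  move=> s0 st ttb; apply: (deriv_gt0_lt (df := N1) st) => c cI.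
    by apply: dN; lra.
  by apply: N10; lra.
have Nle s t : t0 <= s -> s <= t -> t <= tb -> N s <= N t.
  by move=> s0; rewrite le_eqVlt => /predU1P[->//|st] ttb; apply: ltW; exact: Nlt.
have cN t : t0 <= t <= tb -> {for t, continuous N}.
  by move=> tI; exact: deriv_at_continuous (dN _ tI).
have cT t : t0 <= t <= tb -> {for t, continuous T}.
  by move=> tI; exact: deriv_at_continuous (dT _ tI).
have T0 t : t0 <= t <= tb -> 0 < T t by move=> tI; have := Tge _ tI; lra.
move=> x t tI Tx; rewrite ltNge; apply/negP => uN.
have [|||||{uN Tx tI t}x [t [tI Tx uN far]]] := @farthest_contact R D u N T t0 tb cu0 ucoer.
- exact: cN.
- exact: cT.
- exact: Nle.
- exact: T0.
- by exists x, t.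
set dl := ln (enorm x) - T t.
have dl0 : 0 < dl by rewrite subr_gt0.
have t0t : t0 < t.
  rewrite lt_neqAle; apply/andP; split; last by case/andP: tI.
  by apply/eqP => E; have := H0 x; rewrite E -/(T t) => /(_ Tx); lra.
have ttb : t < tb.
  rewrite lt_neqAle; apply/andP; split; last by case/andP: tI.
  by apply/eqP => E; have := Hb x; rewrite -E -/(T t) => /(_ Tx); lra.
have uE : u x = N t.
  apply/eqP; rewrite eq_le uN /=.
  apply: (le_of_left_limit (cN _ tI) t0t) => s t0s st.
  apply: ltW; apply: far; first by rewrite t0s (le_trans (ltW st))// ltW.
  by rewrite ltrD2l ltrN2; apply: Tlt => //; exact: ltW.
pose w := N1 t / T1 t.
pose A := expR (- b * T t) * f (N t) - k * w.
pose q s := th * p s + expR (th * s) * N2 s.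
have dp s : t0 <= s <= tb -> deriv_at p s (q s).
  move=> sI; apply: deriv_at_eq.
    apply: deriv_atM; last exact: dN1.
    by apply: deriv_at_exp; apply: deriv_atZ; exact: deriv_at_id.
  by rewrite /q /p /=; ring.
have zp s : expR (- th * s) * p s = N1 s.
  by rewrite /p mulrA -expRD mulNr addNr expR0 mul1r.
have pq : - (k - th) * p t + expR ((th - b) * t) * f (N t) < q t.
  have e0 := expR_gt0 (th * t).
  have := sub _ tI; rewrite -(ltr_pM2l e0).
  have -> : expR ((th - b) * t) = expR (th * t) * expR (- b * t).
    by rewrite -expRD; congr expR; ring.
  by rewrite /q /p; lra.
have zE : expR (- th * t) * (expR (- b * T t) * f (N t)) <=
    Y t ^+ 2 * (expR ((th - b) * t) * f (N t)).
  have := mass_exponent thb (Tge _ tI); rewrite -YT// => h.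
  by rewrite mulrA [leRHS]mulrA ler_pM2r//; exact/f0/N0.
have E0 : 0 <= expR (- b * T t) * f (N t).
  by rewrite mulr_ge0 ?expR_ge0// ltW// f0// N0.
have Yt := Y0 _ tI; have pt := p0 _ tI; have Wt := W0 _ tI.
have T1t := T10 _ tI; have zt := expR_gt0 (- th * t).
have wE v : N1 t = v * T1 t -> w = v.
  by move=> E; rewrite /w E mulfK// gt_eqF.
have minor_left : t <= t1 -> exists2 e, 0 < e & forall s, t0 <= s <= t1 ->
    `|s - t| < e -> N t + w * (T s - T t) + A / 2 * (T s - T t) ^+ 2 <= N s.
  move=> tt1.
  have incl s : t0 <= s <= t1 -> t0 <= s <= tb by lra.
  have NE s : t0 <= s <= t1 -> N1 s = Y s * W s * T1 s.
    move=> sI; have sb := incl _ sI; have [_ st1] := andP sI.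
    rewrite /T1 gl// -zp.
    by field; rewrite !gt_eqF// ?Y0 ?W0.
  have tI1 : t0 <= t <= t1 by rewrite (ltW t0t).
  have wtE : w = Y t * W t by apply: wE; exact: NE.
  rewrite wtE.
  have dW : deriv_at W t (p t * q t / W t).
    apply: deriv_at_eq.
      apply: (@deriv_at_sqrt _ (fun t => p t ^+ 2 + K)).
        by rewrite ltr_wpDl// sqr_ge0.
      apply: deriv_atD; last exact: deriv_at_cst.
      by apply: (@deriv_atM _ p p); exact: dp.
    by rewrite -/(W t); field; rewrite gt_eqF.
  have dYW := deriv_atM (dY _ tI) dW.
  apply: (@quadratic_minorant R N N1 T T1 (fun s => Y s * W s) t0 t1 t _ A
    tI1 _ _ _ NE dYW).
  - by move=> s /incl; exact: dN.
  - by move=> s /incl; exact: dT.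
  - by move=> s /incl; exact: T10.
  - have -> : T1 t = expR (- th * t) * p t / (W t * Y t).
      by rewrite /T1 gl//; field; rewrite !gt_eqF.
    rewrite -/(g t) (gl _ tt1) /A wtE.
    have -> : - th * expR (- th * t) * (p t / W t) * W t =
        - th * expR (- th * t) * p t by rewrite mulrA divfK// gt_eqF.
    by apply: barrier_energy_ineq (pq) (zE) => //; [exact/ltW/pW|exact: Yle].
have minor_right : t1 <= t -> exists2 e, 0 < e & forall s, t1 <= s <= tb ->
    `|s - t| < e -> N t + w * (T s - T t) + A / 2 * (T s - T t) ^+ 2 <= N s.
  move=> tt1.
  have incl s : t1 <= s <= tb -> t0 <= s <= tb by lra.
  have NE s : t1 <= s <= tb -> N1 s = Y s * p s / mu * T1 s.
    move=> sI; have sb := incl _ sI; have [st1 _] := andP sI.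
    rewrite /T1 gr// -zp.
    by field; rewrite !gt_eqF// ?Y0.
  have tI1 : t1 <= t <= tb by rewrite tt1 ltW.
  have wtE : w = Y t * p t / mu by apply: wE; exact: NE.
  rewrite wtE.
  have dYp : deriv_at (fun s => Y s * p s / mu) t
      ((- th * expR (- th * t) * mu * p t + Y t * q t) / mu).
    rewrite (_ : (fun s => _) = (fun s => mu^-1 * (Y s * p s))); last first.
      by apply/funext => s; rewrite mulrC.
    rewrite [X in deriv_at _ _ X]mulrC; apply: deriv_atZ; apply: deriv_atM.
      by rewrite -(gr _ tt1); exact: dY.
    exact: dp.
  apply: (@quadratic_minorant R N N1 T T1 (fun s => Y s * p s / mu) t1 tb t _ A
    tI1 _ _ _ NE dYp).
  - by move=> s /incl; exact: dN.
  - by move=> s /incl; exact: dT.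
  - by move=> s /incl; exact: T10.
  - rewrite /T1 -/(g t) (gr _ tt1) /A wtE.
    by apply: barrier_scaled_ineq (pq) (zE) => //; rewrite -(gr t1)//; exact: Ymu.
have [e e0 minor] : exists2 e, 0 < e & forall s, t0 <= s <= tb -> `|s - t| < e ->
    N t + w * (T s - T t) + A / 2 * (T s - T t) ^+ 2 <= N s.
  have [tt|tt|tE] := ltgtP t t1.
  - have [e e0 He] := minor_left (ltW tt).
    exists (Num.min e (t1 - t)); first by rewrite lt_min e0 subr_gt0.
    move=> s sI; rewrite lt_min => /andP[se st]; apply: He => //.
    by move: st; rewrite ltr_norml => /andP[_ st]; case/andP: sI => -> _; lra.
  - have [e e0 He] := minor_right (ltW tt).
    exists (Num.min e (t - t1)); first by rewrite lt_min e0 subr_gt0.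
    move=> s sI; rewrite lt_min => /andP[se st]; apply: He => //.
    by move: st; rewrite ltr_norml => /andP[st _]; case/andP: sI => _ ->; lra.
  - have tle : t <= t1 by rewrite tE.
    have tge : t1 <= t by rewrite tE.
    have [e1 e10 He1] := minor_left tle; have [e2 e20 He2] := minor_right tge.
    exists (Num.min e1 e2); first by rewrite lt_min e10.
    move=> s /andP[sI1 sI2]; rewrite lt_min => /andP[s1 s2].
    have [ss|ss] := leP s t1; first by apply: He1 => //; rewrite sI1.
    by apply: He2 => //; rewrite ltW.
have x0 : 0 < enorm x.
  by apply: gt0_of_ln_gt0; apply: lt_trans Tx; exact: T0.
have x1 : 1 <= enorm x.
  by rewrite -[enorm x]lnK// -expR0 ler_expR (le_trans _ (ltW Tx))// ltW// T0.
have ln_x : ln (enorm x) = T t + dl by rewrite /dl addrC subrK.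
have far' y s : t0 <= s <= tb -> dl < ln (enorm y) - T s -> N s <= u y.
  by move=> sI ys; apply: ltW; exact: far.
have := contact_test cu x0 t0t ttb cN cT Tlt ln_x uE far' e0 minor.
rewrite ler_pdivrMr ?exprn_gt0// [laplacian u x * _]mulrC eqn//.
rewrite -kE uE {1}/A subrK ler_pM2r ?f0 ?N0// ler_expR.
by rewrite !mulNr lerN2 ler_pM2l// leNgt Tx.
Qed.

Lemma sqrt_sqrD_le (R : realType) (p S : R) : 0 <= p -> 0 <= S ->
  Num.sqrt (p ^+ 2 + S ^+ 2) <= p + S.
Proof.
move=> p0 S0; rewrite -[leRHS]ger0_norm ?addr_ge0// -sqrtr_sqr ler_sqrt ?sqr_ge0//.
have : 0 <= p * S by rewrite mulr_ge0.
by rewrite sqrrD; lra.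
Qed.

(** [Y] is the antiderivative prescribed by [barrier_slope], normalised at the outer
    end by an arbitrary small value [yb]: the barrier takes its last value at a
    radius as large as desired. *)
Lemma barrier_profile (R : realType) (th K t0 t1 tb yb : R) (N1 : R -> R) :
  0 < th -> 0 < K -> t0 <= t1 -> t1 <= tb ->
  (forall t, t0 <= t <= tb -> {for t, continuous N1}) ->
  (forall t, t0 <= t <= tb -> 0 < N1 t) ->
  0 < yb -> yb <= barrier_slope th K t1 N1 t1 * expR (- th * tb) ->
  exists Y : R -> R,
    [/\ forall t, t0 <= t <= tb ->
          deriv_at Y t (- th * expR (- th * t) * barrier_slope th K t1 N1 t),
        forall t, t0 <= t <= tb -> 0 < Y t <= expR (- th * t) &
        forall t, t1 <= t <= tb -> Y t =
          barrier_slope th K t1 N1 t1 * (expR (- th * t) - expR (- th * tb)) + yb].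
Proof.
move=> th0 K0 t01 t1b cN1 N10 yb0 ybmu.
pose p t := expR (th * t) * N1 t.
pose g := barrier_slope th K t1 N1.
have t0b : t0 <= tb by lra.
have gE t : g t = p (Num.min t t1) / Num.sqrt (p (Num.min t t1) ^+ 2 + K) by [].
have p0 t : t0 <= t <= tb -> 0 < p t.
  by move=> tI; rewrite mulr_gt0 ?expR_gt0 ?N10.
have minI t : t0 <= t <= tb -> t0 <= Num.min t t1 <= tb.
  by move=> /andP[tl tr]; rewrite le_min ge_min tl t01 tr.
have W0 t : 0 < Num.sqrt (p t ^+ 2 + K).
  by rewrite sqrtr_gt0 ltr_wpDl// sqr_ge0.
have g01 t : t0 <= t <= tb -> 0 < g t <= 1.
  move=> tI; have pm := p0 _ (minI _ tI).
  rewrite gE divr_gt0//= ler_pdivrMr// mul1r.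
  rewrite -[leLHS]ger0_norm ?(ltW pm)// -sqrtr_sqr ler_sqrt ?lerDl ?(ltW K0)//.
  by rewrite addr_ge0 ?sqr_ge0// ltW.
have cexp c : continuous (fun t : R => expR (c * t)).
  move=> t; apply: deriv_at_continuous; apply: deriv_at_exp; apply: deriv_atZ.
  exact: deriv_at_id.
have cp t : t0 <= t <= tb -> {for t, continuous p}.
  by move=> tI; exact: (continuousM (cexp th t) (cN1 _ tI)).
have cmin : continuous (fun t : R => Num.min t t1).
  move=> t; apply: (@continuous_min _ _ id (cst t1) t); first exact: cvg_id.
  exact: cvg_cst.
have cg t : t0 <= t <= tb -> {for t, continuous g}.
  move=> tI.
  have c1 : {for t, continuous (fun t => p (Num.min t t1))}.
    exact: (continuous_comp (cmin t) (cp _ (minI _ tI))).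
  have c2 : {for t, continuous (fun t => p (Num.min t t1) ^+ 2 + K)}.
    exact: (continuousD (continuousM c1 c1) (@cst_continuous _ _ K t)).
  have c3 : {for t, continuous
      (fun t => (Num.sqrt (p (Num.min t t1) ^+ 2 + K))^-1)}.
    apply: continuousV; first by rewrite gt_eqF.
    exact: (continuous_comp c2 (@sqrt_continuous R _)).
  exact: (continuousM c1 c3).
pose h t := - th * expR (- th * t) * g t.
have ch t : t0 <= t <= tb -> {for t, continuous h}.
  move=> tI; apply: (continuousM _ (cg _ tI)).
  exact: (continuousM (@cst_continuous _ _ (- th) t) (cexp _ t)).
pose cl t := Num.max t0 (Num.min t tb).
have ccl : continuous cl.
  move=> t; apply: (@continuous_max _ _ (cst t0) (fun t => Num.min t tb) t).
    exact: cvg_cst.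
  apply: (@continuous_min _ _ id (cst tb) t); first exact: cvg_id.
  exact: cvg_cst.
have clI t : t0 <= cl t <= tb.
  by rewrite /cl le_max lexx ge_max t0b ge_min lexx orbT.
have clE t : t0 <= t <= tb -> cl t = t.
  by move=> /andP[t0t ttb]; rewrite /cl min_l// max_r.
have t0m : t0 - 2 < t0 - 1 by lra.
have [|G dG] := @antiderivative R (fun t => h (cl t)) (t0 - 2) (t0 - 1) t0m.
  by move=> t _; exact: (continuous_comp (ccl t) (ch _ (clI t))).
have {}dG t : t0 <= t <= tb -> deriv_at G t (h t).
  by move=> tI; rewrite -{2}(clE _ tI); apply: dG; lra.
pose Y t := G t - G tb + yb.
have dY t : t0 <= t <= tb -> deriv_at Y t (h t).
  move=> tI; apply: deriv_at_eq.
    apply: deriv_atD; last exact: deriv_at_cst.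
    by apply: deriv_atB; [exact: dG|exact: deriv_at_cst].
  by rewrite subr0 addr0.
have Yb : Y tb = yb by rewrite /Y subrr add0r.
have dE c t : deriv_at (fun t => c * expR (- th * t)) t (c * (expR (- th * t) * - th)).
  apply: deriv_atZ; apply: deriv_at_exp; apply: deriv_at_eq.
    by apply: deriv_atZ; exact: deriv_at_id.
  by rewrite mulr1.
have gt1 t : t1 <= t -> g t = g t1.
  by move=> tt; rewrite !gE min_r// minxx.
exists Y; split => // t.
  move=> tI; have [tl tr] := andP tI; apply/andP; split.
    apply: lt_le_trans yb0 _; rewrite -Yb.
    apply: (@deriv_le0_ge _ _ h) => // s sI.
      by apply: dY; lra.
    have /g01/andP[gs _] : t0 <= s <= tb by lra.
    rewrite /h !mulNr oppr_le0 mulr_ge0 ?(ltW gs)// mulr_ge0 ?expR_ge0//.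
    exact: ltW.
  have : Y t - 1 * expR (- th * t) <= Y tb - 1 * expR (- th * tb).
    apply: (@deriv_ge0_le _ (fun s => Y s - 1 * expR (- th * s))
      (fun s => h s - 1 * (expR (- th * s) * - th))) => // s sI.
      by apply: deriv_atB; [apply: dY; lra|exact: dE].
    have /g01/andP[_ gs] : t0 <= s <= tb by lra.
    have -> : h s - 1 * (expR (- th * s) * - th) =
      th * expR (- th * s) * (1 - g s) by rewrite /h; ring.
    by rewrite mulr_ge0 ?subr_ge0// mulr_ge0 ?expR_ge0// ltW.
  have : g t1 * expR (- th * tb) <= 1 * expR (- th * tb).
    rewrite ler_pM2r ?expR_gt0//.
    by have /g01/andP[] : t0 <= t1 <= tb by lra.
  by rewrite Yb; move: ybmu; rewrite -/g; lra.
move=> tI; have [tl tr] := andP tI.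
have dD s : t1 <= s <= tb ->
    deriv_at (fun s => Y s - g t1 * expR (- th * s)) s 0.
  move=> sI; apply: deriv_at_eq.
    by apply: deriv_atB; [apply: dY; lra|exact: dE].
  by rewrite /h gt1; [ring|lra].
have DE : Y t - g t1 * expR (- th * t) = Y tb - g t1 * expR (- th * tb).
  apply/eqP; rewrite eq_le; apply/andP; split.
    apply: (@deriv_ge0_le _ (fun s => Y s - g t1 * expR (- th * s)) (fun=> 0)) => //.
    by move=> s sI; apply: dD; lra.
  apply: (@deriv_le0_ge _ (fun s => Y s - g t1 * expR (- th * s)) (fun=> 0)) => //.
  by move=> s sI; apply: dD; lra.
by rewrite -/g; move: DE; rewrite Yb; lra.
Qed.

(** Up to the factor [- k] this is the derivative of [N] in the variable
    [s = exp (- k t)], in which subsolutions are convex. *)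
Lemma flux_le (R : realType) (k a c : R) (N1 N2 : R -> R) : a <= c ->
  (forall t, a <= t <= c -> deriv_at N1 t (N2 t)) ->
  (forall t, a <= t <= c -> 0 <= N2 t + k * N1 t) ->
  expR (k * a) * N1 a <= expR (k * c) * N1 c.
Proof.
move=> ac dN1 sub.
apply: (@deriv_ge0_le _ (fun t => expR (k * t) * N1 t)
  (fun t => expR (k * t) * (k * 1) * N1 t + expR (k * t) * N2 t)) => // r rI.
  apply: deriv_atM; last by apply: dN1; lra.
  by apply: deriv_at_exp; apply: deriv_atZ; exact: deriv_at_id.
have -> : expR (k * r) * (k * 1) * N1 r + expR (k * r) * N2 r =
  expR (k * r) * (N2 r + k * N1 r) by ring.
by rewrite mulr_ge0 ?expR_ge0// sub//; lra.
Qed.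

(** The slope of the barrier is at least [S], so that a large [S] pushes the value
    [N a] of the barrier to a large radius. *)
Lemma barrier_spread (R : realType) (th S a s t1 : R) (N N1 Y : R -> R) :
  0 < th -> 0 < S -> a <= s -> s <= t1 ->
  (forall t, a <= t <= s -> deriv_at N t (N1 t)) ->
  (forall t, a <= t <= s -> 0 < N1 t) ->
  (forall t, a <= t <= s ->
    deriv_at Y t (- th * expR (- th * t) * barrier_slope th (S ^+ 2) t1 N1 t)) ->
  Y a <= Y s + th / S * (N s - N a).
Proof.
move=> th0 S0 as_ st1 dN N10 dY.
suff : Y a + th / S * N a <= Y s + th / S * N s by lra.
apply: (@deriv_ge0_le _ (fun t => Y t + th / S * N t)
  (fun t => - th * expR (- th * t) * barrier_slope th (S ^+ 2) t1 N1 t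
     + th / S * N1 t)) => // t tI.
  by apply: deriv_atD; [exact: dY|apply: deriv_atZ; exact: dN].
have tI' : a <= t <= s by lra.
have N1t := N10 _ tI'.
rewrite /barrier_slope min_l; last by lra.
set W := Num.sqrt _.
have SW : S <= W.
  rewrite -[leLHS]ger0_norm ?(ltW S0)// -sqrtr_sqr.
  by rewrite ler_sqrt ?lerDr ?sqr_ge0// addr_ge0 ?sqr_ge0.
have W0 : 0 < W by lra.
have zE : expR (- th * t) * expR (th * t) = 1.
  by rewrite -expRD mulNr addNr expR0.
have -> : - th * expR (- th * t) * (expR (th * t) * N1 t / W) + th / S * N1 t =
    - th * (expR (- th * t) * expR (th * t)) * (N1 t / W) + th / S * N1 t.
  by ring.
rewrite zE.
have -> : - th * 1 * (N1 t / W) + th / S * N1 t = th * N1 t * (S^-1 - W^-1) by ring.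
apply: mulr_ge0; first by rewrite mulr_ge0// ltW.
by rewrite subr_ge0 lef_pV2.
Qed.

(** Between [t'] and [t1] the values of [N] drop by the integral of the slope of the
    barrier with respect to [Y], so it suffices to bound the slope of the barrier by
    a multiple of its value [W1] at [t1], that is to bound [p]. Where [p > W1], also
    [p >= S], and [Y] varies at least half as fast as [z]; hence a stretch on which
    [p > W1] is short, its ends have comparable radii, and [flux_le] bounds the
    growth of [p] on it. *)
Lemma barrier_drop (R : realType) (k th S t0 t1 tb t' : R) (N N1 N2 Y : R -> R) :
  0 < th -> th <= k -> 0 < S -> t0 <= t' -> t' <= t1 -> t1 <= tb ->
  (forall t, t0 <= t <= tb -> deriv_at N t (N1 t)) ->
  (forall t, t0 <= t <= tb -> deriv_at N1 t (N2 t)) ->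
  (forall t, t0 <= t <= tb -> 0 < N1 t) ->
  (forall t, t0 <= t <= tb -> 0 <= N2 t + k * N1 t) ->
  (forall t, t0 <= t <= tb ->
    deriv_at Y t (- th * expR (- th * t) * barrier_slope th (S ^+ 2) t1 N1 t)) ->
  Y t' - Y t1 <= 2 * expR (- th * t1) ->
  N t1 - N t' <= 2 * expR ((k - th) * (ln 5 / th)) / th *
    Num.sqrt ((expR (th * t1) * N1 t1) ^+ 2 + S ^+ 2) * (Y t' - Y t1).
Proof.
move=> th0 thk S0 t0t' t't1 t1b dN dN1 N10 sub dY drop.
pose p t := expR (th * t) * N1 t.
pose W t := Num.sqrt (p t ^+ 2 + S ^+ 2).
pose g := barrier_slope th (S ^+ 2) t1 N1.
pose C0 := expR ((k - th) * (ln 5 / th)).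
have C01 : 1 <= C0.
  rewrite -expR0 ler_expR mulr_ge0 ?subr_ge0// divr_ge0 ?ltW//.
  by rewrite ln_gt0// ltr1n.
rewrite -/C0 -/(p t1) -/(W t1).
have p0 t : t0 <= t <= tb -> 0 < p t.
  by move=> tI; rewrite mulr_gt0 ?expR_gt0 ?N10.
have S2 : 0 < S ^+ 2 by rewrite exprn_gt0.
have W0 t : 0 < W t by rewrite sqrtr_gt0 ltr_wpDl// sqr_ge0.
have pW t : t0 <= t <= tb -> p t <= W t.
  move=> tI; rewrite -[leLHS]ger0_norm ?(ltW (p0 _ tI))// -sqrtr_sqr.
  by rewrite ler_sqrt ?lerDl ?(ltW S2)// addr_ge0 ?sqr_ge0.
have SW t : S <= W t.
  rewrite -[leLHS]ger0_norm ?(ltW S0)// -sqrtr_sqr.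
  by rewrite ler_sqrt ?lerDr ?sqr_ge0// addr_ge0 ?sqr_ge0.
have gl t : t <= t1 -> g t = p t / W t.
  by move=> tt; rewrite /g /barrier_slope min_l.
have cp t : t0 <= t <= tb -> {for t, continuous p}.
  move=> tI.
  have dp : deriv_at p t (expR (th * t) * (th * 1) * N1 t + expR (th * t) * N2 t).
    apply: deriv_atM; last exact: dN1.
    by apply: deriv_at_exp; apply: deriv_atZ; exact: deriv_at_id.
  exact: deriv_at_continuous dp.
have dE c t : deriv_at (fun t => c * expR (- th * t)) t (c * (expR (- th * t) * - th)).
  apply: deriv_atZ; apply: deriv_at_exp; apply: deriv_at_eq.
    by apply: deriv_atZ; exact: deriv_at_id.
  by rewrite mulr1.
have t1I : t0 <= t1 <= tb by lra.
have Yle s t : t0 <= s -> s <= t -> t <= t1 -> Y t <= Y s.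
  move=> t0s st tt1.
  apply: (@deriv_le0_ge _ _ (fun t => - th * expR (- th * t) * g t)) => // r rI.
    by apply: dY; lra.
  rewrite gl; last by lra.
  have pr : 0 < p r by apply: p0; lra.
  by rewrite !mulNr oppr_le0 mulr_ge0 ?divr_ge0 ?(ltW pr) ?(ltW (W0 r))// mulr_ge0 ?expR_ge0 ?ltW.
have mono s t : t0 <= s -> s <= t -> t <= t1 ->
    expR (k * s) * N1 s <= expR (k * t) * N1 t.
  by move=> t0s st tt1; apply: (flux_le st) => r rI; [apply: dN1|apply: sub]; lra.
(* s is the end of the stretch that starts at t *)
have pC t : t' <= t <= t1 -> p t <= C0 * W t1.
  move=> /andP[tl tr].
  have [|s [/andP[ts st1] ps above]] := @first_passage R p t t1 (W t1) tr _ (pW _ t1I).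
    by move=> r rI; apply: cp; lra.
  have half : Y s - 2^-1 * expR (- th * s) <= Y t - 2^-1 * expR (- th * t).
    apply: (@deriv_le0_ge _ (fun s => Y s - 2^-1 * expR (- th * s))
      (fun s => - th * expR (- th * s) * g s - 2^-1 * (expR (- th * s) * - th))) => //.
      by move=> r rI; apply: deriv_atB; [apply: dY; lra|exact: dE].
    move=> r /andP[tr' rs]; have r1 : r <= t1 by lra.
    have rI : t0 <= r <= tb by lra.
    have Wp : W t1 < p r by apply: above => //; exact: ltW.
    have W2 : W r <= 2 * p r.
      apply: le_trans (sqrt_sqrD_le _ _) _; rewrite ?(ltW S0)//.
        exact: ltW (p0 _ rI).
      by have := SW t1; lra.
    have -> : - th * expR (- th * r) * g r - 2^-1 * (expR (- th * r) * - th) =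
      - (th * expR (- th * r)) * (g r - 2^-1) by ring.
    rewrite mulNr oppr_le0 mulr_ge0//; first by rewrite mulr_ge0 ?expR_ge0 ?ltW.
    rewrite subr_ge0 gl// ler_pdivlMr ?W0//; lra.
  have es1 : expR (- th * t1) <= expR (- th * s).
    by rewrite ler_expR !mulNr lerN2 ler_pM2l.
  have Yt : Y t <= Y t' by apply: Yle.
  have Ys : Y t1 <= Y s by apply: Yle; lra.
  have e5 : expR (- th * t) <= 5 * expR (- th * s) by lra.
  have st : s - t <= ln 5 / th.
    rewrite ler_pdivlMr//.
    have : expR (th * (s - t)) <= 5.
      have -> : th * (s - t) = - th * t - (- th * s) by ring.
      by rewrite expRB ler_pdivrMr ?expR_gt0.
    by rewrite -[X in _ <= X]lnK ?posrE// ler_expR mulrC.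
  have pe r : p r = expR (- (k - th) * r) * (expR (k * r) * N1 r).
    by rewrite mulrA -expRD /p; congr (expR _ * _); ring.
  have : p t <= expR ((k - th) * (s - t)) * p s.
    have -> : expR ((k - th) * (s - t)) * p s =
        expR (- (k - th) * t) * (expR (k * s) * N1 s).
      by rewrite pe mulrA -expRD; congr (expR _ * _); ring.
    by rewrite pe ler_pM2l ?expR_gt0//; apply: mono; lra.
  move/le_trans; apply.
  apply: ler_pM; [exact: expR_ge0| |by rewrite ler_expR ler_wpM2l// subr_ge0|exact: ps].
  by apply: ltW; apply: p0; lra.
have WC t : t' <= t <= t1 -> W t <= 2 * C0 * W t1.
  move=> tI; have tI0 : t0 <= t <= tb by lra.
  apply: le_trans (sqrt_sqrD_le (ltW (p0 _ tI0)) (ltW S0)) _.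
  have := pC _ tI; have := SW t1.
  have : W t1 <= C0 * W t1 by rewrite ler_peMl// ltW.
  lra.
have : N t1 + 2 * C0 / th * W t1 * Y t1 <= N t' + 2 * C0 / th * W t1 * Y t'.
  apply: (@deriv_le0_ge _ (fun t => N t + 2 * C0 / th * W t1 * Y t)
    (fun t => N1 t + 2 * C0 / th * W t1 * (- th * expR (- th * t) * g t))) => //.
    move=> t tI; apply: deriv_atD; first by apply: dN; lra.
    by apply: deriv_atZ; apply: dY; lra.
  move=> t tI; have tt1 : t <= t1 by lra.
  have N1E : expR (- th * t) * p t = N1 t.
    by rewrite /p mulrA -expRD mulNr addNr expR0 mul1r.
  rewrite gl//.
  have -> : N1 t + 2 * C0 / th * W t1 * (- th * expR (- th * t) * (p t / W t)) =
      N1 t / W t * (W t - 2 * C0 * W t1).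
    by rewrite -N1E; field; rewrite !gt_eqF ?W0.
  apply: mulr_ge0_le0; last by rewrite subr_le0; apply: WC; lra.
  by rewrite divr_ge0 ?(ltW (W0 t))// ltW// N10//; lra.
lra.
Qed.

(** * Comparison of two solutions *)

Lemma coercive_log (R : realType) (D : nat) (u : 'rV[R]_D -> R) (B : R) :
  coercive u -> exists2 L, 0 <= L & forall x, L < ln (enorm x) -> B < u x.
Proof.
move=> /(_ B)[r Hr]; exists (ln (Num.max r 1)).
  by rewrite ln_ge0// le_max lexx orbT.
move=> x Lx; apply: Hr.
have r0 : 0 < Num.max r 1 by rewrite lt_max ltr01 orbT.
have L0 : 0 <= ln (Num.max r 1) by rewrite ln_ge0// le_max lexx orbT.
have x0 : 0 < enorm x by apply: gt0_of_ln_gt0; exact: le_lt_trans Lx.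
by move: Lx; rewrite ltr_ln ?posrE// gt_max => /andP[].
Qed.

(** The barrier is built from [u1] and shown to lie below [u2]; its energy [S^2] is
    fixed by the values of both solutions at bounded radii, so that the barrier takes
    the value [N 1] only where [u2] is larger. For a given far point [x] the
    junction [t1] is put at [ln |x|]. By the choice of the matched slope,
    [W1 (1 - mu) = W1 - p1 <= S], and [barrier_drop] leaves a difference of order
    [S exp (- th t1)], up to errors from the regularisation length [l] and from the
    outer end [tb], which are made small after [t1] is fixed. *)
Lemma solutions_eventually_le (R : realType) (D : nat) (f : R -> R) (b k e : R)
    (u1 u2 : 'rV[R]_D -> R) :
  exterior_solution f b u1 -> exterior_solution f b u2 -> coercive u2 ->
  k = D%:R - 2 -> 0 < k -> 0 < b ->
  (forall t, 0 < t -> {for t, continuous f}) -> (forall t, 0 < t -> 0 < f t) ->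
  0 < e -> exists L, forall x, L < ln (enorm x) -> u1 x - u2 x < e.
Proof.
move=> s1 s2 c2 kE k0 b0 cf f0 e0.
have [cu1 u10 lu1 _] := s1; have [cu10 _] := cu1.
pose M := ball_max u1.
have M0 t : 0 < M t.
  by have [x [_ E _]] := ball_max_attained t cu10; rewrite /M E; exact: u10.
have cM : continuous M := continuous_ball_max cu1 lu1.
have Mle s t : s <= t -> M s <= M t by exact: ball_max_le.
pose th := Num.min k (b / 2).
have th0 : 0 < th by rewrite lt_min k0 divr_gt0.
have thk : th <= k by rewrite ge_min lexx.
have thb : 2 * th <= b.
  have : th <= b / 2 by rewrite ge_min lexx orbT.
  by clear; lra.
have [L2 L20 HL2] := coercive_log (M 1) c2.
(* Y tc <= y0 / 2 whatever S is, and S makes the rest of Y 1 at most y0 / 2 *)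
pose tc := Num.max 1 (L2 + ln 2 / th).
pose y0 := expR (- th * L2).
have y00 : 0 < y0 := expR_gt0 _.
have ln20 : 0 < ln 2 :> R by rewrite ln_gt0// ltr1n.
have tc1 : 1 <= tc by rewrite le_max lexx.
have tcL : L2 + ln 2 / th <= tc by rewrite le_max lexx orbT.
have ln2th : 0 < ln 2 / th by rewrite divr_gt0.
have tcy : expR (- th * tc) <= y0 / 2.
  have -> : y0 / 2 = expR (- th * (L2 + ln 2 / th)).
    have -> : - th * (L2 + ln 2 / th) = - th * L2 - ln 2.
      by field; rewrite gt_eqF.
    by rewrite expRB lnK ?posrE.
  by rewrite ler_expR !mulNr lerN2 ler_pM2l.
pose S := 2 * th * M tc / y0.
have S0 : 0 < S by rewrite divr_gt0// mulr_gt0// mulr_gt0.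
pose C := 2 * expR ((k - th) * (ln 5 / th)) / th.
have C0 : 0 < C by rewrite divr_gt0// mulr_gt0// expR_gt0.
have e3 : 0 < e / 3 by rewrite divr_gt0.
have CS0 : 0 < C * S by rewrite mulr_gt0.
exists (Num.max tc (- ln (e / 3 / (C * S)) / th)) => x.
set t1 := ln (enorm x); rewrite gt_max => /andP[tct1 t1e].
have t11 : 1 < t1 by exact: le_lt_trans tct1.
have L2t1 : L2 < t1.
  by apply: le_lt_trans tct1; apply: le_trans tcL; rewrite lerDl ltW.
pose z1 := expR (- th * t1).
have z10 : 0 < z1 := expR_gt0 _.
have CSz1 : C * S * z1 < e / 3.
  rewrite mulrC -ltr_pdivlMr// -[ltRHS]lnK ?posrE ?divr_gt0// ltr_expR.
  by move: t1e; rewrite ltr_pdivrMr//; clear; lra.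
have x0 : 0 < enorm x by apply: gt0_of_ln_gt0; exact: lt_trans t11.
have u1M : u1 x <= M t1.
  have [_ [_ _]] := ball_max_attained t1 cu10; apply.
  by rewrite lnK.
have [l [l0 l4 Ml]] : exists l, [/\ 0 < l, l < 1 / 4 & M t1 - M (t1 - 2 * l) < e / 3].
  have /nbhs_ballP[d /= d0 Hd] : \forall s \near t1, M t1 - e / 3 < M s.
    by apply: (cvgr_gt _ (cM t1)); rewrite ltrBlDr ltrDl.
  pose m := Num.min d 1.
  have m0 : 0 < m by rewrite lt_min d0 ltr01.
  have md : m <= d by rewrite ge_min lexx.
  have m1 : m <= 1 by rewrite ge_min lexx orbT.
  exists (m / 8); split; [by rewrite divr_gt0|by clear - m1 m0; lra|].
  have : M t1 - e / 3 < M (t1 - 2 * (m / 8)).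
    apply: Hd; rewrite /ball /= opprB addrC subrK gtr0_norm ?mulr_gt0 ?divr_gt0//.
    by clear - md m0; lra.
  by clear; lra.
(* a bound for W1 that does not depend on tb *)
pose B1 := expR (th * t1) * (expR k * M (t1 + 1)) + S.
have B10 : 0 < B1.
  by apply: addr_gt0 => //; do 2 (apply: mulr_gt0; first exact: expR_gt0); exact: M0.
pose X := Num.min (z1 / 2) (e / (7 * C * B1)).
have CB0 : 0 < C * B1 by rewrite mulr_gt0.
have CB7 : 0 < 7 * C * B1 by apply: mulr_gt0 => //; exact: mulr_gt0.
have X0 : 0 < X by rewrite lt_min !divr_gt0.
pose tb := Num.max (t1 + 1) (- ln X / th).
have t1b : t1 + 1 <= tb by rewrite le_max lexx.
pose e2 := expR (- th * tb).
have e20 : 0 < e2 := expR_gt0 _.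
have e2X : e2 <= X.
  rewrite -[leRHS]lnK ?posrE// ler_expR mulNr lerNl mulrC -ler_pdivrMr//.
  by rewrite le_max lexx orbT.
have e2z : e2 <= z1 / 2 by apply: le_trans e2X _; rewrite ge_min lexx.
have e2B : 2 * (C * B1) * e2 < e / 3.
  have : e2 <= e / (7 * C * B1) by apply: le_trans e2X _; rewrite ge_min lexx orbT.
  rewrite ler_pdivlMr// => h.
  by clear - h e0; lra.
have l2 : 2 * l < 1 by clear - l4; lra.
have tb1 : 1 < tb by clear - t11 t1b; lra.
have [N [N1 [N2 HN]]] := smooth_subsolution s1 kE k0 b0 cf f0 l0 l2 tb1.
have dN t : 1 <= t <= tb -> deriv_at N t (N1 t) by move=> /HN[].
have dN1 t : 1 <= t <= tb -> deriv_at N1 t (N2 t) by move=> /HN[].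
have N10 t : 1 <= t <= tb -> 0 < N1 t by move=> /HN[].
have sub t : 1 <= t <= tb -> expR (- b * t) * f (N t) < N2 t + k * N1 t.
  by move=> /HN[].
have NM t : 1 <= t <= tb -> N t <= M t by move=> /HN[_ _ _ _ /andP[]].
have MN t : 1 <= t <= tb -> M (t - 2 * l) <= N t by move=> /HN[_ _ _ _ /andP[]].
have N0 t : 1 <= t <= tb -> 0 < N t by move=> /MN; apply: lt_le_trans.
have sub0 t : 1 <= t <= tb -> 0 <= N2 t + k * N1 t.
  move=> tI; apply: le_trans (ltW (sub _ tI)).
  by rewrite mulr_ge0 ?expR_ge0// ltW// f0// N0.
have cN1 t : 1 <= t <= tb -> {for t, continuous N1}.
  by move=> tI; exact: deriv_at_continuous (dN1 _ tI).
have t1I : 1 <= t1 <= tb by clear - t11 t1b; lra.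
have S2 : 0 < S ^+ 2 by rewrite exprn_gt0.
pose p1 := expR (th * t1) * N1 t1.
pose W1 := Num.sqrt (p1 ^+ 2 + S ^+ 2).
have p10 : 0 < p1 by rewrite mulr_gt0 ?expR_gt0// N10.
have W10 : 0 < W1 by rewrite sqrtr_gt0 ltr_wpDl// sqr_ge0.
have W1S : W1 <= p1 + S by apply: sqrt_sqrD_le; exact: ltW.
pose mu := barrier_slope th (S ^+ 2) t1 N1 t1.
have muE : mu = p1 / W1 by rewrite /mu /barrier_slope minxx.
have mu0 : 0 < mu by rewrite muE divr_gt0.
have mu1 : mu <= 1.
  rewrite muE ler_pdivrMr// mul1r -[leLHS]ger0_norm ?(ltW p10)// -sqrtr_sqr.
  by rewrite ler_sqrt ?lerDl ?(ltW S2)// addr_ge0 ?sqr_ge0.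
have W1B : W1 <= B1.
  apply: le_trans W1S _; rewrite lerD2r ler_pM2l ?expR_gt0//.
  have tt : t1 < t1 + 1 by rewrite ltrDl.
  have [|c /andP[c1 c2'] Nc] := @deriv_mean_value R N N1 t1 (t1 + 1) tt.
    by move=> c cI; apply: dN; clear - cI t11 t1b; lra.
  have cI : 1 <= c <= tb by clear - c1 c2' t11 t1b; lra.
  have fl : expR (k * t1) * N1 t1 <= expR (k * c) * N1 c.
    apply: (flux_le (ltW c1)) => r rI; [apply: dN1|apply: sub0];
      clear - rI cI t11; lra.
  have t2I : 1 <= t1 + 1 <= tb by clear - t11 t1b; lra.
  have N1c : N1 c <= M (t1 + 1).
    have := NM _ t2I; have := N0 _ t1I; move: Nc.
    rewrite [t1 + 1 - t1]addrAC subrr add0r mulr1.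
    by clear; lra.
  have -> : N1 t1 = expR (- (k * t1)) * (expR (k * t1) * N1 t1).
    by rewrite mulrA -expRD addNr expR0 mul1r.
  apply: (@le_trans _ _ (expR (- (k * t1)) * (expR (k * c) * N1 c))).
    by rewrite ler_pM2l ?expR_gt0.
  rewrite mulrA -expRD.
  apply: ler_pM; [exact: expR_ge0|exact/ltW/N10| |exact: N1c].
  rewrite ler_expR.
  have : k * (c - t1) <= k * 1.
    by rewrite ler_pM2l//; clear - c2'; lra.
  by clear; lra.
have [Lb Lb0 HLb] := coercive_log (M tb) c2.
pose yb := Num.min (expR (- th * Lb)) (mu * e2).
have yb0 : 0 < yb by rewrite lt_min expR_gt0 mulr_gt0.
have ybmu : yb <= mu * expR (- th * tb) by rewrite ge_min lexx orbT.
have ybL : yb <= expR (- th * Lb) by rewrite ge_min lexx.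
have t11' : 1 <= t1 by exact: ltW.
have t1b' : t1 <= tb by case/andP: t1I.
have [Y [dY Y0 Yr]] := barrier_profile th0 S2 t11' t1b' cN1 N10 yb0 ybmu.
have Ypos t : 1 <= t <= tb -> 0 < Y t by move=> /Y0/andP[].
have Yle t : 1 <= t <= tb -> Y t <= expR (- th * t) by move=> /Y0/andP[].
have bI : t1 <= tb <= tb by rewrite t1b' lexx.
have Yb : Y tb = yb by rewrite Yr// subrr mulr0 add0r.
have Ymu t : t1 <= t <= tb -> Y t <= mu * expR (- th * t).
  move=> tI; rewrite Yr// -/mu mulrBr.
  by move: ybmu; clear; lra.
have oneI : 1 <= (1 : R) <= tb by rewrite lexx ltW.
have log_far y L t : 0 < y -> y <= expR (- th * L) -> - ln y / th < t -> L < t.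
  move=> y_gt0 yL; apply: le_lt_trans; rewrite ler_pdivlMr//.
  have : ln y <= - th * L by rewrite -ler_expR lnK.
  by clear; lra.
have Y1 : Y 1 <= y0.
  have h : Y 1 <= Y tc + th / S * (N tc - N 1).
    apply: (barrier_spread th0 S0 tc1 (ltW tct1)) => t tI.
    - by apply: dN; clear - tI tct1 t1b; lra.
    - by apply: N10; clear - tI tct1 t1b; lra.
    - by apply: dY; clear - tI tct1 t1b; lra.
  have tcI : 1 <= tc <= tb by clear - tc1 tct1 t1b; lra.
  have h1 := Yle _ tcI.
  have h2 : th / S * (N tc - N 1) <= th / S * M tc.
    have thS : 0 < th / S by exact: divr_gt0.
    rewrite ler_pM2l//.
    by have := NM _ tcI; have := N0 _ oneI; clear; lra.
  have h3 : th / S * M tc = y0 / 2.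
    by rewrite /S; field; rewrite !gt_eqF// M0.
  by move: h h1 h2 tcy; rewrite h3; clear; lra.
have below y t : 1 <= t <= tb -> - ln (Y t) / th < ln (enorm y) -> N t < u2 y.
  apply: (barrier_comparison s2 c2 kE th0 thk thb S2 f0 ltr01 t11' t1b' N0 dN dN1
    N10 sub dY Ypos Yle Ymu) => {}y Hy.
  - apply: le_lt_trans (NM _ oneI) _; apply: HL2.
    exact: log_far (Ypos _ oneI) Y1 Hy.
  - have tbI : 1 <= tb <= tb by rewrite (ltW tb1) lexx.
    apply: le_lt_trans (NM _ tbI) _; apply: HLb.
    by apply: log_far Hy; rewrite Yb.
have Yt1 : mu * z1 - e2 <= Y t1.
  rewrite Yr ?lexx// -/mu -/e2 -/z1 mulrBr.
  have : mu * e2 <= 1 * e2 by rewrite ler_pM2r.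
  by clear - yb0; lra.
(* the barrier takes the value N t' at radius |x| or earlier: if Y 1 is already too
   small, N 1 itself is below u2 x *)
have [t' [t'1 t't1 Nt' drop]] : exists t', [/\ 1 <= t', t' <= t1, N t' < u2 x &
    Y t' - Y t1 <= (1 - mu) * z1 + 2 * e2].
  have [Yv|vY] := leP (Y 1) (z1 + e2).
    exists 1; split => //.
      apply: le_lt_trans (NM _ oneI) _; exact: HL2.
    by clear - Yv Yt1; lra.
  have cY : {within `[1, t1], continuous Y}.
    have cYin : {in [set` `[1, t1]], continuous Y}.
      move=> s; rewrite inE /= in_itv /= => sI.
      have sI' : 1 <= s <= tb by clear - sI t1b'; lra.
      exact: deriv_at_continuous (dY _ sI').
    exact: continuous_in_subspaceT.
  have Y1z : Y t1 <= z1 by exact: Yle.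
  have [|t' t'I Yt'] := @IVT R Y 1 t1 (z1 + e2) t11' cY.
    rewrite ge_min le_max; apply/andP; split; apply/orP; [right|left].
      by clear - Y1z e20; lra.
    exact: ltW.
  move: t'I; rewrite in_itv /= => /andP[t'1 t't1].
  exists t'; split => //; last by rewrite Yt'; clear - Yt1; lra.
  apply: below; first by rewrite t'1 (le_trans t't1).
  rewrite -/t1 Yt' ltr_pdivrMr// ltrNl -ltr_expR lnK ?posrE ?addr_gt0//.
  have -> : expR (- (t1 * th)) = z1 by rewrite /z1; congr expR; ring.
  by rewrite ltrDl.
have drop2 : Y t' - Y t1 <= 2 * expR (- th * t1).
  apply: le_trans drop _; rewrite -/z1.
  have : 0 <= mu * z1 by rewrite mulr_ge0 ?ltW.
  by clear - e2z; lra.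
have := barrier_drop th0 thk S0 t'1 t't1 t1b' dN dN1 N10 sub0 dY drop2.
rewrite -/C -/p1 -/W1 => NN.
have CW0 : 0 < C * W1 by rewrite mulr_gt0.
have {}NN : N t1 - N t' <= C * W1 * ((1 - mu) * z1 + 2 * e2).
  by apply: le_trans NN _; rewrite ler_pM2l.
have key : C * W1 * ((1 - mu) * z1 + 2 * e2) <= C * S * z1 + 2 * (C * B1) * e2.
  have -> : C * W1 * ((1 - mu) * z1 + 2 * e2) =
      C * (W1 - p1) * z1 + 2 * (C * W1) * e2.
    by rewrite muE; field; rewrite gt_eqF.
  apply: lerD.
    by rewrite ler_pM2r// ler_pM2l// lerBlDl.
  by rewrite ler_pM2r// ler_pM2l// ler_pM2l.
have := MN _ t1I.
clear - u1M Ml Nt' NN key CSz1 e2B.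
lra.
Qed.

Lemma C1_half_line_continuous (R : realType) (f : R -> R) (t : R) :
  C1_half_line f -> 0 < t -> {for t, continuous f}.
Proof.
move=> [f' [_ df]] t0.
have pos : \forall s \near t^', [set` `[0, +oo[] s.
  apply: nbhs_dnbhs; near=> s; rewrite /= in_itv /= andbT ltW//.
  by near: s; exact: (cvgr_gt t cvg_id).
have quot : (f s - f t) / (s - t) @[s --> t^'] --> f' t.
  apply: cvg_trans (df t (ltW t0)); apply: cvg_app => P HP.
  by apply: filterS2 pos HP => s s0; apply.
have lin : s - t @[s --> t^'] --> t - t.
  by apply: cvgB; [apply: cvg_within_filter; exact: cvg_id|exact: cvg_cst].
have prod : f t + (f s - f t) / (s - t) * (s - t) @[s --> t^'] -->
    f t + f' t * (t - t).
  by apply: cvgD; [exact: cvg_cst|exact: cvgM].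
rewrite subrr mulr0 addr0 in prod.
apply/continuous_withinNx; apply: cvg_trans prod; apply: near_eq_cvg.
near=> s; rewrite /= divfK; first by rewrite addrC subrK.
by rewrite subr_eq0; near: s; exact: nbhs_dnbhs_neq.
Unshelve. all: by end_near. Qed.

Lemma entire_large_solution_exterior (R : realType) (D : nat) (f : R -> R)
    (rho : 'rV[R]_D -> R) (alpha : R) (u : 'rV[R]_D -> R) :
  (forall t, 0 < t -> 0 < f t) -> (forall x, 0 < rho x) ->
  (forall x, 1 <= enorm x -> rho x = enorm x `^ (- alpha)) ->
  entire_large_solution rho f u -> exterior_solution f (alpha - 2) u.
Proof.
move=> f0 rho0 rhoE [cu u0 eqn _]; split => //.
  by move=> x; rewrite eqn mulr_gt0// f0.
move=> x x1; rewrite eqn rhoE// mulrA.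
have x0 : 0 < enorm x by exact: lt_le_trans x1.
congr (_ * _); rewrite /powR gt_eqF// -[X in X ^+ 2](lnK x0) -expRM_natl -expRD.
by congr expR; ring.
Qed.

Lemma entire_large_solution_coercive (R : realType) (D : nat) (f : R -> R)
    (rho : 'rV[R]_D -> R) (u : 'rV[R]_D -> R) :
  entire_large_solution rho f u -> coercive u.
Proof.
move=> [_ _ _ /cvgryPgt cvu] B.
by have [r _ Hr] := cvu B; exists r.
Qed.

Theorem theorem2p11 (R : realType) (D : nat) (hD : (3 <= D)%N)
    (f : R -> R) (a : R) (rho : 'rV[R]_D -> R) (alpha : R)
    (f_C1 : C1_half_line f)
    (f_nontrivial : exists2 t, 0 <= t & f t != 0)
    (f0 : f 0 = 0)
    (f_gt0 : forall t, 0 < t -> 0 < f t)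
    (a_gt0 : 0 < a)
    (f_KO : Keller_Osserman f a)
    (rho_gt0 : forall x, 0 < rho x)
    (rho_C1 : class_C 1 rho)
    (rho_potential : potential rho x @[x --> rV_pinfty R D] --> 0%E)
    (alpha_gt2 : 2 < alpha)
    (rho_power : forall x, 1 <= enorm x -> rho x = enorm x `^ (- alpha))
    (u1 u2 : 'rV[R]_D -> R)
    (u1_sol : entire_large_solution rho f u1)
    (u2_sol : entire_large_solution rho f u2) :
  u1 x - u2 x @[x --> rV_pinfty R D] --> 0.
Proof.
have ext u := @entire_large_solution_exterior R D f rho alpha u f_gt0 rho_gt0 rho_power.
have s1 := ext _ u1_sol; have s2 := ext _ u2_sol.
have c1 := entire_large_solution_coercive u1_sol.
have c2 := entire_large_solution_coercive u2_sol.
have cf t : 0 < t -> {for t, continuous f} by exact: C1_half_line_continuous.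
have b0 : 0 < alpha - 2 by rewrite subr_gt0.
have k0 : 0 < D%:R - 2 :> R by rewrite subr_gt0 ltr_nat.
apply/cvgrPdist_lt => e e0.
have [L HL] := solutions_eventually_le s1 s2 c2 erefl k0 b0 cf f_gt0 e0.
have [L' HL'] := solutions_eventually_le s2 s1 c1 erefl k0 b0 cf f_gt0 e0.
exists (expR (Num.max L L')) => // x /= Lx.
have x0 : 0 < enorm x by apply: lt_trans Lx; exact: expR_gt0.
have : Num.max L L' < ln (enorm x) by rewrite -ltr_expR lnK.
rewrite gt_max => /andP[/HL h /HL' h'].
by rewrite sub0r normrN ltr_norml; lra.
Qed.
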